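(* Suppose that the payoff on simultaneous stopping is $M=L$, that $l$ is lower semicontinuous and $u$ is upper semicontinuous. Suppose that (i) the value $v^C(x)$ of the Dynkin game under the common Poisson constraint exists for every $x\in\mathcal{X}$ and satisfies $$v^C(x)=\mathbb{E}^x\Big[e^{-rT_1^C}\max\big\{l(X_{T_1^C}),\min(v^C(X_{T_1^C}),u(X_{T_1^C}))\big\}\Big];$$ (ii) the value $v^I(x)$ of the Dynkin game under the independent Poisson constraint exists for every $x\in\mathcal{X}$ and satisfies $$v^I(x)=\mathbb{E}^x\Big[e^{-r(T_1^M\wedge T_1^m)}\Big(\max\{l(X_{T_1^M}),v^I(X_{T_1^M})\}\mathbf{1}_{\{T_1^M<T_1^m\}}+\min\{u(X_{T_1^m}),v^I(X_{T_1^m})\}\mathbf{1}_{\{T_1^m<T_1^M\}}\Big)\Big].$$ Suppose that $v^I=v^C$ and that $v:=v^I\equiv v^C$ is continuous. Then $v\wedge l\le u$ on $\mathcal{X}$.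
   Context: Setting. $(\Omega,\mathcal{F},\mathbb{F}=(\mathcal{F}_t)_{t\ge 0},\mathbb{P})$ is a filtered probability space satisfying the usual conditions and supporting a regular linear (time-homogeneous) diffusion $X$ driven by a one-dimensional Brownian motion $W$, with state space an open interval $\mathcal{X}\subset\mathbb{R}$; $X$ does not die inside $\mathcal{X}$ and the endpoints of $\mathcal{X}$ are not exit points. $\mathbb{P}^x,\mathbb{E}^x$ denote probability and expectation conditional on $X_0=x$. Fix $r>0$, $\lambda>0$ and non-negative functions $l,u$ on $\mathcal{X}$; set $L_t=e^{-rt}l(X_t)$, $U_t=e^{-rt}u(X_t)$. $M_\infty$ is an $\mathcal{F}_\infty$-measurable random variable (the payoff if neither player stops). The payoff is $$R(\tau,\sigma)=L_\tau\mathbf{1}_{\{\tau\le\sigma<\infty\}\cup\{\tau<\sigma=\infty\}}+U_\sigma\mathbf{1}_{\{\sigma<\tau\}}+M_\infty\mathbf{1}_{\{\tau=\sigma=\infty\}},$$ (on simultaneous stopping the payoff is $L$; this is the convention $M=L$). $J^x(\tau,\sigma)=\mathbb{E}^x[R(\tau,\sigma)]$; the \textsc{sup} player chooses $\tau$ to maximise and the \textsc{inf} player chooses $\sigma$ to minimise $J^x$. Common Poisson constraint. $(T^C_n)_{1\le n\le\infty}$, $T^C_\infty=\infty$, are the jump times of a Poisson process of rate $\lambda$ independent of $L,U,M_\infty$; $\mathcal{R}^C(\lambda)$ is the set of stopping times $\gamma$ with $\gamma(\omega)=T^C_n(\omega)$ for some $n\in\{1,\dots,\infty\}$. The value $v^C(x)$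 exists if $\inf_\sigma\sup_\tau J^x(\tau,\sigma)=\sup_\tau\inf_\sigma J^x(\tau,\sigma)=:v^C(x)$ over $\tau,\sigma\in\mathcal{R}^C(\lambda)$. Independent Poisson constraint. $(T^M_n)_{1\le n\le\infty}$ and $(T^m_n)_{1\le n\le\infty}$ (with $T^M_\infty=T^m_\infty=\infty$) are the jump times of two independent Poisson processes, each of rate $\lambda$, independent of $L,U,M_\infty$; $\mathcal{R}^M(\lambda)$, $\mathcal{R}^m(\lambda)$ are the sets of stopping times taking values in $\{T^M_n\}$, resp. $\{T^m_n\}$, $n\in\{1,\dots,\infty\}$. The value $v^I(x)$ exists if $\inf_\sigma\sup_\tau J^x(\tau,\sigma)=\sup_\tau\inf_\sigma J^x(\tau,\sigma)=:v^I(x)$ over $\tau\in\mathcal{R}^M(\lambda)$, $\sigma\in\mathcal{R}^m(\lambda)$. *)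

(* Defs.v *)
From HB Require Import structures.
From mathcomp Require Import all_boot all_order all_algebra.
From mathcomp Require Import all_classical all_reals all_analysis.
From mathcomp Require Import measurable_realfun.

Set Implicit Arguments.
Unset Strict Implicit.
Unset Printing Implicit Defensive.

Import Order.TTheory GRing.Theory Num.Theory.
Import numFieldNormedType.Exports.

Local Open Scope classical_set_scope.
Local Open Scope ring_scope.

(* Time is indexed by R and only times t with 0 <= t are ever constrained.
   Random times take values in \bar R, +oo standing for "never".
   The laws P^x, x in the state space E, are a family P : R -> probability Omega R
   whose members P x with x outside E are never used. *)

Section semicontinuity.
Context {R : realType}.

Definition lsc_on (E : set R) (f : R -> R) :=
  lower_semicontinuous (fun x : subspace E => (f x)%:E).

Definition usc_on (E : set R) (f : R -> R) :=
  forall (x : subspace E) (a : R), f x < a ->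
    exists2 V, nbhs x V & forall y, V y -> f y < a.

End semicontinuity.

Section filtrations.
Context {R : realType} {d : measure_display} {Omega : measurableType d}.
Implicit Types (F : R -> set (set Omega)) (P : R -> probability Omega R).

Definition filtration F :=
  [/\ forall t : R, 0 <= t -> sigma_algebra setT (F t),
      forall t : R, 0 <= t -> F t `<=` measurable
    & forall s t : R, 0 <= s -> s <= t -> F s `<=` F t].

(* For a family of mutually singular laws P^x (x in E), completeness concerns
   the sets that are null under all of them, as usual for Markov processes:
   if F 0 contained the null sets of each single P^x, it would already contain
   every event up to P^y-null sets, for every y. *)
Definition usual_conditions (E : set R) P F :=
  (forall t : R, 0 <= t -> \bigcap_(s in [set s : R | t < s]) F s = F t) /\
  (forall A, (forall x, E x -> (P x).-negligible A) -> F 0 A).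

Definition F_infty F : set (set Omega) :=
  <<s \bigcup_(t in [set t : R | 0 <= t]) F t >>.

Definition adapted d' (S : measurableType d') F (Y : R -> Omega -> S) :=
  forall t : R, 0 <= t -> forall B, measurable B -> F t (Y t @^-1` B).

Definition stopping_time F (tau : Omega -> \bar R) :=
  (forall w, (0 <= tau w)%E) /\
  (forall t : R, 0 <= t -> F t [set w | (tau w <= t%:E)%E]).

Definition F_stopped F (tau : Omega -> \bar R) : set (set Omega) :=
  [set A | F_infty F A /\
           forall t : R, 0 <= t -> F t (A `&` [set w | (tau w <= t%:E)%E])].

(* X_tau; a junk value where tau = +oo. *)
Definition at_time (S : Type) (X : R -> Omega -> S) (tau : Omega -> \bar R) :=
  fun w => X (fine (tau w)) w.

Definition cylinders d' (S : measurableType d') (Y : R -> Omega -> S) :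
    set (set Omega) :=
  \bigcup_(t in [set t : R | 0 <= t]) preimage_set_system setT (Y t) measurable.

End filtrations.

Section independence.
Context {R : realType} {d : measure_display} {Omega : measurableType d}.
Variable Q : probability Omega R.

Definition indep2 (G H : set (set Omega)) :=
  forall A B, G A -> H B -> Q (A `&` B) = (Q A * Q B)%E.

(* For set systems containing setT, such as sigma-algebras, this is mutual
   independence. *)
Definition indep3 (G H K : set (set Omega)) :=
  forall A B C, G A -> H B -> K C ->
    Q (A `&` B `&` C) = (Q A * Q B * Q C)%E.

End independence.

Section brownian_and_poisson.
Context {R : realType} {d : measure_display} {Omega : measurableType d}.
Variables (Q : probability Omega R) (F : R -> set (set Omega)).

Definition brownian_motion (W : R -> Omega -> R) :=
  [/\ adapted F W,
      forall w, W 0 w = 0,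
      forall w, {within `[0, +oo[, continuous (fun t => W t w)}
    & forall s t : R, 0 <= s -> s < t ->
        forall B : set R, measurable B ->
          let D := [set w | B (W t w - W s w)] in
          Q D = normal_prob 0 (Num.sqrt (t - s)) B /\
          forall A, F s A -> Q (A `&` D) = (Q A * Q D)%E].

Definition poisson_process (lam : R) (N : R -> Omega -> nat) :=
  [/\ adapted F N,
      forall w, N 0 w = 0%N,
      forall w (s t : R), 0 <= s -> s <= t -> (N s w <= N t w)%N,
      forall w (t : R), 0 <= t -> \forall s \near t^'+, N s w = N t w
    & forall s t : R, 0 <= s -> s < t ->
        forall k : nat,
          let D := [set w | (N t w - N s w)%N = k] in
          Q D = (poisson_pmf (lam * (t - s)) k)%:E /\
          forall A, F s A -> Q (A `&` D) = (Q A * Q D)%E].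

End brownian_and_poisson.

Section jump_times.
Context {R : realType} {d : measure_display} {Omega : measurableType d}.

Definition jump_time (N : R -> Omega -> nat) (n : nat) (w : Omega) : \bar R :=
  ereal_inf [set t%:E | t in [set t : R | 0 <= t /\ (n <= N t w)%N]].

Definition poisson_stopping_times (F : R -> set (set Omega))
    (N : R -> Omega -> nat) : set (Omega -> \bar R) :=
  [set gamma | stopping_time F gamma /\
     forall w, (exists2 n, (0 < n)%N & gamma w = jump_time N n w) \/
               gamma w = +oo%E].

End jump_times.

Section ito.
Context {R : realType} {d : measure_display} {Omega : measurableType d}.

(* sum_(i < size) val_i 1_(time_i, time_(i+1)] *)
Record simple_process := SimpleProcess {
  sp_size : nat ;
  sp_time : nat -> R ;
  sp_val : nat -> Omega -> R }.

Definition sp_predictable (F : R -> set (set Omega)) (S : simple_process) :=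
  [/\ 0 <= sp_time S 0,
      forall i, sp_time S i <= sp_time S i.+1,
      forall i (B : set R), measurable B -> F (sp_time S i) (sp_val S i @^-1` B)
    & forall i, exists M, forall w, `|sp_val S i w| <= M].

Definition sp_eval (S : simple_process) (t : R) (w : Omega) : R :=
  \sum_(i < sp_size S)
     sp_val S i w * \1_(`]sp_time S i, sp_time S i.+1]) t.

Definition sp_integral (S : simple_process) (W : R -> Omega -> R)
    (t : R) (w : Omega) : R :=
  \sum_(i < sp_size S)
     sp_val S i w *
     (W (Num.min (sp_time S i.+1) t) w - W (Num.min (sp_time S i) t) w).

Definition vanishes_in_probability (Q : probability Omega R)
    (Y : nat -> Omega -> \bar R) :=
  forall e : R, 0 < e -> Q [set w | (e%:E <= Y n w)%E] @[n --> \oo] --> 0%E.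

(* I_t = \int_0^t H dW for all t, Q-almost surely: I_t is the limit in
   probability of the elementary integrals of simple predictable processes
   approximating H in L^2(0, t), in probability. *)
Definition is_ito_integral (Q : probability Omega R)
    (F : R -> set (set Omega)) (W H I : R -> Omega -> R) :=
  exists2 S : nat -> simple_process,
    forall n, sp_predictable F (S n) &
    forall t : R, 0 <= t ->
      vanishes_in_probability Q (fun n w =>
        \int[lebesgue_measure]_(s in [set` `[0, t]%R])
           ((sp_eval (S n) s w - H s w) ^+ 2)%:E)%E /\
      vanishes_in_probability Q (fun n w =>
        `|sp_integral (S n) W t w - I t w|%:E).

End ito.

Section diffusions.
Context {R : realType} {d : measure_display} {Omega : measurableType d}.
Variables (E : set R) (P : R -> probability Omega R)
          (F : R -> set (set Omega)).

Definition strong_markov (X : R -> Omega -> R) :=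
  (forall (t : R) (B : set R), 0 <= t -> measurable B ->
     measurable_fun E (fun y : R => P y (X t @^-1` B))) /\
  (forall x, E x -> forall tau, stopping_time F tau ->
   forall A, F_stopped F tau A ->
   forall (t : R) (B : set R), 0 <= t -> measurable B ->
     let A' := A `&` [set w | (tau w < +oo)%E] in
     (P x (A' `&` [set w | B (X (fine (tau w) + t)%R w)]) =
      \int[P x]_(w in A') P (at_time X tau w) (X t @^-1` B))%E).

Definition hitting_time (X : R -> Omega -> R) (y : R) (w : Omega) : \bar R :=
  ereal_inf [set t%:E | t in [set t : R | 0 <= t /\ X t w = y]].

Definition regular (X : R -> Omega -> R) :=
  forall x y, E x -> E y ->
    (0 < P x [set w | (hitting_time X y w < +oo)%E])%E.

(* dX_t = a(X_t) dt + b(X_t) dW_t under every P^x *)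
Definition driven_by (W X : R -> Omega -> R) :=
  (forall x, E x -> brownian_motion (P x) F W) /\
  exists a b : R -> R,
    [/\ measurable_fun E a, measurable_fun E b
      & forall x, E x ->
        (forall t : R, 0 <= t -> {ae P x, forall w,
           lebesgue_measure.-integrable `[0, t] (fun s => (a (X s w))%:E)}) /\
        is_ito_integral (P x) F W (fun s w => b (X s w))
          (fun t w => X t w - X 0 w -
             \int[lebesgue_measure]_(s in [set` `[0, t]%R]) a (X s w))].

(* X never leaves the open interval E: it is not killed inside E, and no
   endpoint of E is reached in finite time. *)
Definition linear_diffusion (W X : R -> Omega -> R) :=
  [/\ adapted F X /\ (forall w (t : R), 0 <= t -> E (X t w)),
      forall w, {within `[0, +oo[, continuous (fun t => X t w)},
      forall x, E x -> P x [set w | X 0 w = x] = 1%E,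
      strong_markov X
    & regular X /\ driven_by W X].

End diffusions.

Section dynkin_game.
Context {R : realType} {d : measure_display} {Omega : measurableType d}.

(* e^{-rt}, with e^{-r oo} = 0 *)
Definition discount (r : R) (t : \bar R) : R :=
  if t is s%:E then expR (- (r * s)) else 0.

Definition payoff (r : R) (l u : R -> R) (X : R -> Omega -> R)
    (Minf : Omega -> R) (tau sigma : Omega -> \bar R) (w : Omega) : R :=
  discount r (tau w) * l (at_time X tau w) *
    \1_([set w | (tau w <= sigma w < +oo)%E] `|`
        [set w | (tau w < sigma w)%E /\ sigma w = +oo%E]) w +
  discount r (sigma w) * u (at_time X sigma w) *
    \1_([set w | (sigma w < tau w)%E]) w +
  Minf w * \1_([set w | tau w = +oo%E /\ sigma w = +oo%E]) w.

(* J^x(tau, sigma) *)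
Definition expected_payoff (P : R -> probability Omega R) (r : R)
    (l u : R -> R) (X : R -> Omega -> R) (Minf : Omega -> R) (x : R)
    (tau sigma : Omega -> \bar R) : \bar R :=
  'E_(P x)[payoff r l u X Minf tau sigma]%E.

(* tau in A maximises, sigma in B minimises *)
Definition is_game_value (A B : set (Omega -> \bar R))
    (J : (Omega -> \bar R) -> (Omega -> \bar R) -> \bar R) (v : \bar R) :=
  ereal_inf [set ereal_sup [set J tau sigma | tau in A] | sigma in B] = v /\
  ereal_sup [set ereal_inf [set J tau sigma | sigma in B] | tau in A] = v.

End dynkin_game.

(* Main.v *)
Require Import Defs.
From HB Require Import structures.
From mathcomp Require Import all_boot all_order all_algebra.
From mathcomp Require Import all_classical all_reals all_analysis.
From mathcomp Require Import measurable_realfun giry.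
From mathcomp Require Import ring lra.

Set Implicit Arguments.
Unset Strict Implicit.
Unset Printing Implicit Defensive.

Import Order.TTheory GRing.Theory Num.Theory.
Import numFieldNormedType.Exports.

Local Open Scope classical_set_scope.
Local Open Scope ring_scope.

(** Write v for the common value, f = max(l, min(v, u)) for the one-step payoff
under the common clock, and R_q h(x) = E^x[\int_0^oo e^(-qt) h(X_t) dt] for the
resolvent of the diffusion.

A Poisson clock of rate lam that is independent of X turns each fixed-point
equation into a resolvent identity. The first jump of the common clock has
density lam e^(-lam t), so v = lam R_(r+lam) f. With two independent clocks, the
event that a given one rings first, at time t, has density lam e^(-2 lam t), so
v = lam R_(r+2lam) (max(l, v) + min(u, v)). These are sampled_resolvent and
sampled_resolvent_race.

The two identities have different rates, and the resolvent equation
R_p = R_q + (q - p) R_q R_p (resolvent_eq) removes the difference: the first one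
gives v = lam R_(r+2lam) f + lam R_(r+2lam) (lam R_(r+lam) f)
= lam R_(r+2lam) (f + v). As v is finite, subtraction yields R_(r+2lam) g = 0 for
the gap g = f + v - max(l, v) - min(u, v) (resolvent_gap_eq0).

The gap is nonnegative, and it is positive exactly where u < min(v, l)
(one_step_gap_ge0, one_step_gap_gt0). If u < min(v, l) held at some x, then by
semicontinuity of l and u and continuity of v it would hold near x. Paths started
at x stay near x for a positive time, so R_(r+2lam) g(x) would be positive
(resolvent_eq0_not_near_pos), a contradiction.

The resolvent equation needs the law of X_t under P^y as a kernel that is jointly
measurable in (y, t) and satisfies the Chapman-Kolmogorov equation. Joint
measurability is obtained from measurability in y at each t and path continuity
in t (measurable_law), and Chapman-Kolmogorov is the strong Markov property at
constant times (chapman_kolmogorov). *)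

(** * Joint measurability of processes with continuous paths *)

Section caratheodory.
Context {R : realType} d (T : measurableType d).

Lemma truncn_scale_cvg (t : R) : 0 <= t ->
  (Num.truncn (n.+1%:R * t))%:R / n.+1%:R @[n --> \oo] --> t.
Proof.
move=> t0; apply: (@squeeze_cvgr _ _ _ _ (fun n => t - n.+1%:R^-1) (fun=> t)).
- apply: nearW => n; have n0 : 0 < n.+1%:R :> R by [].
  have nt0 : 0 <= n.+1%:R * t by rewrite mulr_ge0.
  have /andP[h1 h2] := truncn_itv nt0.
  rewrite ler_pdivrMr// [t * _]mulrC h1 andbT ler_pdivlMr// mulrBl mulVf// mulrC.
  by rewrite lerBlDr natr1 ltW.
- rewrite -[X in _ --> X]subr0; apply: cvgB; first exact: cvg_cst.
  exact: cvg_harmonic.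
- exact: cvg_cst.
Qed.

(** A function that is measurable in w and continuous in t is the limit of its
    discretizations, which freeze t at a multiple of 1/(n+1) and hence take
    countably many branches. Evaluating at `|t| lets a family that is controlled
    on nonnegative times only be treated as a function on the whole line. *)
Lemma measurable_fun_caratheodory (g : T -> R -> \bar R) :
  (forall t, 0 <= t -> measurable_fun setT (g ^~ t)) ->
  (forall w (s_ : R^nat) s, (forall n, 0 <= s_ n) -> s_ n @[n --> \oo] --> s ->
     g w (s_ n) @[n --> \oo] --> g w s) ->
  measurable_fun setT (fun p : T * R => g p.1 `|p.2|).
Proof.
move=> mg cg.
pose q n (t : R) : nat := Num.truncn (n.+1%:R * `|t|).
pose G n (p : T * R) := g p.1 ((q n p.2)%:R / n.+1%:R).
apply: (emeasurable_fun_cvg G); last first.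
  move=> [w t] _; apply: cg => [n|]; first by rewrite divr_ge0.
  exact: truncn_scale_cvg.
move=> n _ B mB; rewrite setTI.
have mq k : measurable (q n @^-1` [set k]).
  pose b (t : R) := (k%:R <= n.+1%:R * `|t|) && (n.+1%:R * `|t| < k.+1%:R).
  rewrite (_ : _ @^-1` _ = b @^-1` [set true]); last first.
    apply/seteqP; split => t /=; rewrite /q /b.
      by move=> <-; rewrite truncn_itv// mulr_ge0.
    by move=> h; apply: truncn_def.
  have mm : measurable_fun setT (fun t : R => n.+1%:R * `|t|).
    by apply: measurable_funM => //; exact: measurable_normr.
  have mb : measurable_fun setT b.
    by apply: measurable_and; [exact: measurable_fun_ler|exact: measurable_fun_ltr].
  by rewrite -[X in measurable X]setTI; exact: mb.
rewrite (_ : _ @^-1` _ =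
  \bigcup_k ((g ^~ (k%:R / n.+1%:R) @^-1` B) `*` (q n @^-1` [set k]))); last first.
  apply/seteqP; split => [[w t] /= Bwt|[w t] /= [k _ [Bg qk]]].
    by exists (q n t).
  by rewrite /G /= qk.
apply: bigcupT_measurable => k; apply: measurableX => //.
by rewrite -[X in measurable X]setTI; apply: mg => //; rewrite divr_ge0.
Qed.

End caratheodory.

Lemma within_continuous_seq {R : realType} (f : R -> R) (s_ : R^nat) s :
  {within `[0, +oo[, continuous f} -> (forall n, 0 <= s_ n) ->
  s_ n @[n --> \oo] --> s -> f (s_ n) @[n --> \oo] --> f s.
Proof.
move=> /subspace_continuousP cf s0 ss.
have s_ge0 : 0 <= s.
  rewrite -(cvg_lim (@Rhausdorff R) ss); apply: limr_ge.
    by apply/cvg_ex; exists s.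
  by apply: nearW => n.
have /cf h : `[0, +oo[%classic s by rewrite /= in_itv/= s_ge0.
have hs : s_ n @[n --> \oo] --> within `[0, +oo[ (nbhs s).
  move=> U hU; have [N _ hN] := ss _ hU; exists N => // n Nn.
  by apply: (hN n Nn); rewrite /= in_itv/= s0.
apply: cvg_comp hs _; exact: h.
Qed.

Lemma measurable_process {R : realType} d (T : measurableType d) (Y : R -> T -> R) :
  (forall t, 0 <= t -> measurable_fun setT (Y t)) ->
  (forall w, {within `[0, +oo[, continuous (fun t => Y t w)}) ->
  measurable_fun setT (fun p : T * R => Y `|p.2| p.1).
Proof.
move=> mY cY; apply/measurable_EFinP.
apply: (@measurable_fun_caratheodory R _ T (fun w t => (Y t w)%:E)).
  by move=> t t0; apply/measurable_EFinP; exact: mY.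
move=> w s_ s s0 ss; apply: cvg_EFin; first exact: nearW.
exact: (@within_continuous_seq _ (fun t => Y t w)).
Qed.

Lemma measurable_at_time {R : realType} d (Omega : measurableType d)
    (X : R -> Omega -> R) (tau : Omega -> \bar R) :
  (forall t, 0 <= t -> measurable_fun setT (X t)) ->
  (forall w, {within `[0, +oo[, continuous (fun t => X t w)}) ->
  measurable_fun setT tau -> (forall w, (0 <= tau w)%E) ->
  measurable_fun setT (at_time X tau).
Proof.
move=> mX cX mtau tau0.
have -> : at_time X tau = fun w => X `|fine (tau w)| w.
  by apply/funext => w; rewrite /at_time ger0_norm// fine_ge0.
have mg : measurable_fun setT (fun w => (w, fine (tau w))).
  by apply: measurable_fun_pair => //; exact: measurableT_comp.
exact: (measurableT_comp (measurable_process mX cX) mg).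
Qed.

(** * Exponential weights and Lebesgue integrals *)

Section exponential_weights.
Context {R : realType}.
Local Notation mu := (@lebesgue_measure R).

Definition expweight (a t : R) : R :=
  expR (- (a * t)) * \1_(`[0, +oo[%classic) t.

Lemma expweight_ge0 a t : 0 <= expweight a t.
Proof. by rewrite /expweight mulr_ge0// expR_ge0. Qed.

Lemma expweightE a t : 0 <= t -> expweight a t = expR (- (a * t)).
Proof. by move=> t0; rewrite /expweight indicE mem_set ?mulr1//= in_itv/= t0. Qed.

Lemma expweight_lt0 a t : t < 0 -> expweight a t = 0.
Proof.
move=> t0; rewrite /expweight indicE memNset ?mulr0//= in_itv/= andbT.
by apply/negP; rewrite -ltNge.
Qed.

Lemma measurable_expweight a : measurable_fun setT (expweight a).
Proof.
apply: measurable_funM => //.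
apply: measurableT_comp => //; apply: measurableT_comp => //.
Qed.

Lemma exponential_pdf_expweight a t : exponential_pdf a t = a * expweight a t.
Proof.
have [t0|t0] := leP 0 t; first by rewrite exponential_pdfE// expweightE// mulNr.
by rewrite lt0_exponential_pdf// expweight_lt0// mulr0.
Qed.

Lemma exponential_prob_itvcc0 (lam u : R) : 0 <= u ->
  exponential_prob lam `[0, u] = (1 - (expR (- (lam * u)))%:E)%E.
Proof.
rewrite le_eqVlt => /predU1P[<-|u0]; last by rewrite exponential_prob_itv0c// mulNr.
by rewrite mulr0 oppr0 expR0 subee// /exponential_prob set_itv1 integral_set1.
Qed.

(** The resolvent equation for the translation semigroup of the half-line; every
    other resolvent equation follows from it by integration. *)
Lemma expweight_conv (a b u : R) : a < b ->
  ((b - a)%:E * \int[mu]_t ((expweight b t)%:E * (expweight a (u - t))%:E) +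
   (expweight b u)%:E = (expweight a u)%:E)%E.
Proof.
move=> ab; have ba0 : 0 < b - a by rewrite subr_gt0.
have [u0|u0] := ltP u 0.
  rewrite !expweight_lt0// adde0 integral0_eq ?mule0// => t _.
  have [t0|t0] := leP 0 t; last by rewrite expweight_lt0// mul0e.
  by rewrite (_ : expweight a _ = 0) ?mule0// expweight_lt0//; lra.
(* on [0, u] the integrand is e^(-au) e^(-(b-a)t), an exponential density up to
   a constant, and elsewhere it vanishes *)
have -> : (\int[mu]_t ((expweight b t)%:E * (expweight a (u - t))%:E) =
    \int[mu]_(t in `[0%R, u])
      ((expR (- (a * u)) / (b - a))%:E * (exponential_pdf (b - a) t)%:E))%E.
  rewrite [RHS]integral_mkcond; apply: eq_integral => t _.
  rewrite patchE; case: ifPn.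
    rewrite inE/= in_itv/= => /andP[t0 tu].
    rewrite !expweightE// ?subr_ge0// exponential_pdf_expweight expweightE//.
    rewrite -!EFinM.
    congr EFin; rewrite mulrA divfK ?gt_eqF// -!expRD; congr expR; ring.
  rewrite notin_setE/= in_itv/= => /negP; rewrite negb_and -!ltNge => /orP[t0|ut].
    by rewrite expweight_lt0// mul0e.
  by rewrite (@expweight_lt0 a) ?mule0// subr_lt0.
rewrite ge0_integralZl//; first last.
- by rewrite lee_fin divr_ge0 ?expR_ge0// ltW.
- by move=> x _; rewrite lee_fin exponential_pdf_ge0// ltW.
- by apply/measurable_EFinP/measurable_funTS; exact: measurable_exponential_pdf.
rewrite -/(exponential_prob (b - a) `[0, u]).
rewrite exponential_prob_itvcc0//.
rewrite !expweightE// -EFinB -!EFinM -EFinD; congr EFin.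
rewrite mulrA mulrCA divff ?gt_eqF// mulr1 mulrBr mulr1 -expRD.
rewrite (_ : - (a * u) + _ = - (b * u)); last by ring.
by rewrite subrK.
Qed.

Lemma ge0_integral_translation (f : R -> \bar R) (s : R) :
  measurable_fun setT f -> (forall x, 0 <= f x)%E ->
  (\int[mu]_t f (t + s)%R = \int[mu]_t f t)%E.
Proof.
move=> mf f0.
pose phi (t : measurableTypeR R) : measurableTypeR R := t + s.
have mphi : measurable_fun setT phi by exact: measurable_funD.
have mphiE A : measurable A -> pushforward mu phi A = mu A.
  move=> mA; apply/esym/lebesgue_measure_unique => //= _ [[a b]] _ <-.
  rewrite /pushforward (_ : phi @^-1` _ = `]a - s, b - s]%classic); last first.
    by apply/seteqP; split => t /=; rewrite !in_itv/= /phi ltrBlDr lerBrDr.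
  rewrite !lebesgue_measure_itv/= !lte_fin ltrBlDr subrK.
  by case: ifP => // _; rewrite -!EFinB; congr EFin; ring.
transitivity (\int[pushforward mu phi]_t f t)%E.
  by rewrite ge0_integral_pushforward// preimage_setT.
by apply: eq_measure_integral => A mA _; exact: mphiE.
Qed.

End exponential_weights.

(** * Resolvents of a measurable transition semigroup *)

Section mixture.
Context {R : realType} d1 d2 (W : measurableType d1) (S : measurableType d2).

Lemma ge0_integral_mixture (nu : probability W R) (k : W -> probability S R)
    (m : probability S R) (h : S -> \bar R) :
  (forall B, measurable B -> measurable_fun setT (fun w => k w B)) ->
  (forall B, measurable B -> m B = \int[nu]_w k w B)%E ->
  measurable_fun setT h -> (forall y, 0 <= h y)%E ->
  (\int[m]_y h y = \int[nu]_w \int[k w]_y h y)%E.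
Proof.
move=> mk mE mh h0.
have mk' : measurable_fun setT (k : W -> giry S R).
  by apply: measurable_giry_codensity.
rewrite -[RHS](giry_int_bind nu mk' mh h0).
apply: eq_measure_integral => B mB _.
transitivity (\int[nu]_w k w B)%E; first exact: mE.
rewrite /giry_bind/=.
rewrite /giry_int ge0_integral_pushforward//.
exact: measurable_giry_ev.
Qed.

End mixture.

Lemma ge0_scaled_cancel {R : realType} (c : R) (x y z : \bar R) :
  (0 < c)%R -> (0 <= y)%E -> (0 <= z)%E -> (c%:E * x)%E \is a fin_num ->
  (x = y + z)%E -> (c%:E * x = c%:E * z)%E -> y = 0%E.
Proof.
move=> c0 y0 z0 cx_fin xE cxE.
have : (c%:E * x = c%:E * y + c%:E * x)%E by rewrite {2}cxE xE ge0_muleDr.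
move=> /(congr1 (fun t => t - c%:E * x)%E).
rewrite addeK// subee// => /esym/eqP.
by rewrite mule_eq0 eqe gt_eqF//= => /eqP.
Qed.

Section transition_semigroup.
Context {R : realType} d (S : measurableType d).
Local Notation mu := (@lebesgue_measure R).
Variable K : S -> R -> probability S R.
Hypothesis mK : forall B, measurable B ->
  measurable_fun setT (fun p : S * R => K p.1 p.2 B).
Hypothesis CK : forall x s t, 0 <= s -> 0 <= t -> forall B, measurable B ->
  (K x (s + t)%R B = \int[K x s]_y K y t B)%E.

Local Open Scope ereal_scope.

Definition transition (t : R) (h : S -> \bar R) (x : S) := \int[K x t]_y h y.

Lemma transition_ge0 t h x : (forall y, 0 <= h y) -> 0 <= transition t h x.
Proof. by move=> h0; exact: integral_ge0. Qed.

Lemma measurable_transition h : measurable_fun setT h -> (forall y, 0 <= h y) ->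
  measurable_fun setT (fun p : S * R => transition p.2 h p.1).
Proof.
move=> mh h0.
exact: (@measurable_fun_integral_kernel _ _ _ _ R (fun p : S * R => K p.1 p.2)).
Qed.

Lemma measurable_transition_time h x : measurable_fun setT h ->
  (forall y, 0 <= h y) -> measurable_fun setT (fun t : R => transition t h x).
Proof.
move=> mh h0.
have /measurable_fun_pair2 := measurable_transition mh h0; exact.
Qed.

Lemma transitionD s t h x : (0 <= s)%R -> (0 <= t)%R ->
  measurable_fun setT h -> (forall y, 0 <= h y) ->
  transition (s + t)%R h x = transition s (transition t h) x.
Proof.
move=> s0 t0 mh h0; apply: ge0_integral_mixture => //; last by move=> B; exact: CK.
by move=> B /mK /measurable_fun_pair1; exact.
Qed.

Definition resolvent (a : R) (h : S -> \bar R) (x : S) :=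
  \int[mu]_t ((expweight a t)%:E * transition t h x).

Lemma resolvent_ge0 a h x : (forall y, 0 <= h y) -> 0 <= resolvent a h x.
Proof.
move=> h0; apply: integral_ge0 => t _.
by rewrite mule_ge0 ?lee_fin ?expweight_ge0// transition_ge0.
Qed.

Lemma measurable_resolvent_integrand a h :
  measurable_fun setT h -> (forall y, 0 <= h y) ->
  measurable_fun setT
    (fun p : S * R => (expweight a p.2)%:E * transition p.2 h p.1).
Proof.
move=> mh h0; apply: emeasurable_funM; last exact: measurable_transition.
apply/measurable_EFinP; apply: measurableT_comp => //; exact: measurable_expweight.
Qed.

Lemma measurable_resolvent a h : measurable_fun setT h -> (forall y, 0 <= h y) ->
  measurable_fun setT (resolvent a h).
Proof.
move=> mh h0.
have := @measurable_fun_fubini_tonelli_F _ _ S (measurableTypeR R) R mu _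
  (measurable_resolvent_integrand a mh h0).
apply=> p; by rewrite mule_ge0 ?lee_fin ?expweight_ge0// transition_ge0.
Qed.

Lemma resolventZ a (c : R) h x :
  measurable_fun setT h -> (forall y, 0 <= h y) -> (0 <= c)%R ->
  resolvent a (fun y => c%:E * h y) x = c%:E * resolvent a h x.
Proof.
move=> mh h0 c0; rewrite /resolvent -ge0_integralZl//; first last.
- by move=> t _; rewrite mule_ge0 ?lee_fin ?expweight_ge0// transition_ge0.
- apply: emeasurable_funM; last exact: measurable_transition_time.
  by apply/measurable_EFinP; exact: measurable_expweight.
apply: eq_integral => t _; rewrite /transition ge0_integralZl//.
by rewrite muleCA.
Qed.

Lemma resolventD a h1 h2 x : measurable_fun setT h1 -> (forall y, 0 <= h1 y) ->
  measurable_fun setT h2 -> (forall y, 0 <= h2 y) ->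
  resolvent a (fun y => h1 y + h2 y) x = resolvent a h1 x + resolvent a h2 x.
Proof.
move=> m1 h10 m2 h20; rewrite /resolvent -ge0_integralD//; first last.
- apply: emeasurable_funM; last exact: measurable_transition_time.
  by apply/measurable_EFinP; exact: measurable_expweight.
- by move=> t _; rewrite mule_ge0 ?lee_fin ?expweight_ge0// transition_ge0.
- apply: emeasurable_funM; last exact: measurable_transition_time.
  by apply/measurable_EFinP; exact: measurable_expweight.
- by move=> t _; rewrite mule_ge0 ?lee_fin ?expweight_ge0// transition_ge0.
apply: eq_integral => t _; rewrite /transition ge0_integralD//.
by rewrite ge0_muleDr// integral_ge0.
Qed.

(** Chapman-Kolmogorov under the time integral, followed by the shift u = t + s,
    which moves the dependence on t from the semigroup to the weight. *)
Lemma transition_resolvent a h t x :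
  (0 <= t)%R -> measurable_fun setT h -> (forall y, 0 <= h y) ->
  transition t (resolvent a h) x =
  \int[mu]_u ((expweight a (u - t))%:E * transition u h x).
Proof.
move=> t0 mh h0.
have w0 u v : 0 <= (expweight a u)%:E * transition v h x.
  by rewrite mule_ge0 ?lee_fin ?expweight_ge0// transition_ge0.
transitivity (\int[mu]_s \int[K x t]_y ((expweight a s)%:E * transition s h y)).
  rewrite /transition /resolvent.
  rewrite (@fubini_tonelli _ _ S (measurableTypeR R) R (K x t) mu
     (fun p : S * R => (expweight a p.2)%:E * transition p.2 h p.1))//.
    exact: measurable_resolvent_integrand.
  by move=> p; rewrite mule_ge0 ?lee_fin ?expweight_ge0// transition_ge0.
transitivity (\int[mu]_s ((expweight a s)%:E * transition (s + t)%R h x)).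
  apply: eq_integral => s _.
  rewrite ge0_integralZl ?lee_fin ?expweight_ge0//; first last.
  - by move=> y _; exact: transition_ge0.
  - have /measurable_fun_pair1 := measurable_transition mh h0; exact.
  have [s0|s0] := leP 0%R s; last by rewrite expweight_lt0// !mul0e.
  by rewrite addrC transitionD.
rewrite -[RHS](@ge0_integral_translation _ _ t)//.
  by under [RHS]eq_integral do rewrite addrK.
apply: emeasurable_funM; last exact: measurable_transition_time.
apply/measurable_EFinP; apply: measurableT_comp; first exact: measurable_expweight.
exact: measurable_funB.
Qed.

(** Tonelli reduces the iterated resolvent to one time integral of the semigroup
    against the convolution of the two weights. It is stated additively because
    resolvents of nonnegative functions may be infinite. *)
Lemma resolvent_eq a b h x :
  (a < b)%R -> measurable_fun setT h -> (forall y, 0 <= h y) ->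
  resolvent a h x =
  resolvent b h x + (b - a)%:E * resolvent b (resolvent a h) x.
Proof.
move=> ab mh h0.
have ba0 : (0 <= b - a)%R by rewrite subr_ge0 ltW.
have Tr0 u : 0 <= transition u h x by exact: transition_ge0.
have mTr := measurable_transition_time x mh h0.
pose c u := \int[mu]_t ((expweight b t)%:E * (expweight a (u - t))%:E).
pose F (p : R * R) : \bar R :=
  (expweight b p.1)%:E * (expweight a (p.2 - p.1))%:E * transition p.2 h x.
have F0 p : 0 <= F p by rewrite !mule_ge0// lee_fin expweight_ge0.
have mW : measurable_fun setT
    (fun p : R * R => (expweight b p.1)%:E * (expweight a (p.2 - p.1))%:E).
  apply: emeasurable_funM; apply/measurable_EFinP; apply: measurableT_comp => //;
    try exact: measurable_expweight.
  exact: measurable_funB.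
have mF : measurable_fun setT F.
  apply: emeasurable_funM => //.
  exact: (measurableT_comp mTr).
have mc : measurable_fun setT c.
  have := @measurable_fun_fubini_tonelli_G _ _
    (measurableTypeR R) (measurableTypeR R) R mu _ mW.
  by apply=> p; rewrite mule_ge0// lee_fin expweight_ge0.
have c0 u : 0 <= c u.
  by apply: integral_ge0 => t _; rewrite mule_ge0// lee_fin expweight_ge0.
have -> : resolvent b (resolvent a h) x = \int[mu]_u (c u * transition u h x).
  transitivity (\int[mu]_t \int[mu]_u F (t, u)).
    apply: eq_integral => t _; rewrite /F/=.
    have [t0|t0] := leP 0%R t; last first.
      by rewrite expweight_lt0// mul0e integral0_eq// => u _; rewrite !mul0e.
    rewrite transition_resolvent// -ge0_integralZl ?lee_fin ?expweight_ge0//.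
    - by apply: eq_integral => u _; rewrite muleA.
    - apply: emeasurable_funM => //.
      apply/measurable_EFinP; apply: measurableT_comp; last exact: measurable_funB.
      exact: measurable_expweight.
    - by move=> u _; rewrite mule_ge0// lee_fin expweight_ge0.
  rewrite (@fubini_tonelli _ _ (measurableTypeR R) (measurableTypeR R) R mu mu F)//.
  apply: eq_integral => u _; rewrite /F/= ge0_integralZr//.
  - have /measurable_fun_pair1 := mW; exact.
  - by move=> t _; rewrite mule_ge0// lee_fin expweight_ge0.
rewrite -ge0_integralZl//; first last.
- by move=> u _; rewrite mule_ge0.
- exact: emeasurable_funM.
rewrite /resolvent -ge0_integralD//; first last.
- by apply: measurable_funeM; exact: emeasurable_funM.
- by move=> u _; rewrite !mule_ge0.
- apply: emeasurable_funM => //.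
  by apply/measurable_EFinP; exact: measurable_expweight.
- by move=> u _; rewrite mule_ge0// lee_fin expweight_ge0.
apply: eq_integral => u _.
rewrite -(expweight_conv u ab) -/(c u) addeC muleA.
rewrite ge0_muleDl// ?lee_fin ?expweight_ge0//.
by rewrite mule_ge0.
Qed.

(** The resolvent equation reads c R_a f = c R_(a+c) (f + c R_a f), and R_(a+c)
    does not distinguish c R_a f from v. Hence c R_(a+c) (g + p) = c R_(a+c) p at
    x, and finiteness allows the subtraction. *)
Lemma resolvent_gap_eq0 a c f v g p x : (0 < c)%R ->
  measurable_fun setT f -> (forall y, 0 <= f y) ->
  measurable_fun setT v -> (forall y, 0 <= v y) ->
  measurable_fun setT g -> (forall y, 0 <= g y) ->
  measurable_fun setT p -> (forall y, 0 <= p y) ->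
  (forall y, f y + v y = g y + p y) ->
  c%:E * resolvent a f x \is a fin_num ->
  resolvent (a + c) v x =
    resolvent (a + c) (fun y => c%:E * resolvent a f y) x ->
  c%:E * resolvent a f x = c%:E * resolvent (a + c) p x ->
  resolvent (a + c) g x = 0.
Proof.
move=> c0 mf f0 mv v0 mg g0 mp p0 fvgp fin_fx vE pE.
have ac : (a < a + c)%R by rewrite ltrDl.
have Rf0 y : 0 <= resolvent a f y by exact: resolvent_ge0.
have cE : (a + c - a)%R = c by rewrite addrAC subrr add0r.
have := resolvent_eq x ac mf f0; rewrite cE => eq_f.
have eq_c := resolventZ (a + c) x (measurable_resolvent a mf f0) Rf0 (ltW c0).
have eq_fv := resolventD (a + c) x mf f0 mv v0.
have eq_gp := resolventD (a + c) x mg g0 mp p0.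
have fvgpE : (fun y => f y + v y) = (fun y => g y + p y) by exact: funext.
rewrite fvgpE in eq_fv.
apply: (ge0_scaled_cancel c0 _ _ fin_fx _ pE).
- exact: resolvent_ge0.
- exact: resolvent_ge0.
- by rewrite -eq_gp eq_fv vE eq_c.
Qed.

End transition_semigroup.

(** * Exponential times *)

Section density.
Context {R : realType} d (T : measurableType d).
Variables (nu m : {measure set T -> \bar R}) (f : T -> R).
Hypotheses (mf : measurable_fun setT f) (f0 : forall x, 0 <= f x).
Hypothesis mE : forall B, measurable B -> (m B = \int[nu]_(x in B) (f x)%:E)%E.

Local Open Scope ereal_scope.
Import HBNNSimple.

Let integral_density_nnsfun (g : {nnsfun T >-> R}) :
  \int[m]_x (g x)%:E = \int[nu]_x ((g x)%:E * (f x)%:E).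
Proof.
rewrite integralT_nnsfun sintegralE.
transitivity (\sum_(r \in range g)
  \int[nu]_x (r%:E * ((\1_(g @^-1` [set r]) x)%:E * (f x)%:E))).
  apply: eq_fsbigr => r /set_mem [y _ <-].
  rewrite ge0_integralZl//; first last.
  - by rewrite lee_fin.
  - by move=> x _; rewrite mule_ge0// lee_fin.
  - apply: emeasurable_funM; exact/measurable_EFinP.
  congr (_ * _); rewrite mE// integral_mkcond; apply: eq_integral => x _.
  rewrite patchE indicE; case: ifPn => _; first by rewrite mul1e.
  by rewrite mul0e.
rewrite -ge0_integral_fsum//; first last.
- move=> r x _; rewrite muleA; apply: mule_ge0; last by rewrite lee_fin.
  exact: nnfun_muleindic_ge0.
- move=> r; apply: measurable_funeM; apply: emeasurable_funM; exact/measurable_EFinP.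
apply: eq_integral => x _.
under eq_fsbigr do rewrite muleA.
rewrite -ge0_mule_fsuml; last by move=> r; exact: nnfun_muleindic_ge0.
by congr (_ * _); rewrite [in RHS]fimfunE -fsumEFin//.
Qed.

Lemma ge0_integral_density (h : T -> \bar R) :
  measurable_fun setT h -> (forall x, 0 <= h x) ->
  \int[m]_x h x = \int[nu]_x (h x * (f x)%:E).
Proof.
move=> mh h0; pose g := nnsfun_approx measurableT mh.
transitivity (limn (fun n => \int[m]_x (g n x)%:E)).
  rewrite -monotone_convergence//.
  - by apply: eq_integral => x _; apply/esym/cvg_lim => //; exact: cvg_nnsfun_approx.
  - by move=> n; exact/measurable_EFinP.
  - by move=> n x _; rewrite lee_fin.
  - by move=> x _ a b ab; rewrite lee_fin; exact/lefP/nd_nnsfun_approx.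
transitivity (limn (fun n => \int[nu]_x ((g n x)%:E * (f x)%:E))).
  by apply: congr_lim; apply/funext => n; exact: integral_density_nnsfun.
rewrite -monotone_convergence//.
- apply: eq_integral => x _; apply/cvg_lim => //.
  apply: cvgeZr => //.
  exact: cvg_nnsfun_approx.
- by move=> n; apply: emeasurable_funM; exact/measurable_EFinP.
- by move=> n x _; rewrite mule_ge0// lee_fin.
- move=> x _ a b ab; apply: lee_wpmul2r; first by rewrite lee_fin.
  rewrite lee_fin; exact/lefP/nd_nnsfun_approx.
Qed.

End density.

(** The value +oo is allowed, since the first jump of a counting process is
    infinite on paths that never jump; the law forces this to be a null event. *)
Definition is_exponential_time {R : realType} d (Omega : measurableType d)
    (Q : probability Omega R) (lam : R) (tau : Omega -> \bar R) :=
  [/\ measurable_fun setT tau, forall w, (0 <= tau w)%E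
    & forall t, 0 <= t ->
        Q [set w | (t%:E < tau w)%E] = (expR (- (lam * t)))%:E].

Section exponential_time.
Context {R : realType} d (Omega : measurableType d).
Variables (Q : probability Omega R) (lam : R) (tau : Omega -> \bar R).
Hypotheses (lam0 : 0 < lam) (tau_exp : is_exponential_time Q lam tau).
Local Open Scope ereal_scope.

Let mtau : measurable_fun setT tau. Proof. by have [] := tau_exp. Qed.
Let tau0 w : 0 <= tau w. Proof. by have [_ +] := tau_exp; exact. Qed.
Let tau_gt (t : R) : (0 <= t)%R ->
  Q [set w | t%:E < tau w] = (expR (- (lam * t)))%:E.
Proof. by have [_ _] := tau_exp; exact. Qed.

Lemma setI_closed_rays : setI_closed (@RGenOInfty.G R).
Proof.
move=> _ _ [a ->] [b ->]; exists (Num.max a b).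
by apply/seteqP; split => x/=; rewrite !in_itv/= !andbT gt_max => /andP.
Qed.

Lemma exponential_time_fin : {ae Q, forall w, tau w < +oo}.
Proof.
exists [set w | tau w = +oo]; split.
- rewrite -[X in measurable X]setTI.
  exact: (mtau measurableT (@emeasurable_set1 R +oo)).
- apply/eqP; rewrite eq_le measure_ge0 andbT.
  apply/lee_addgt0Pr => e e0; rewrite add0e.
  (* past time |ln e| / lam the tail is at most e *)
  apply: (@le_trans _ _ (Q [set w | (`|ln e| / lam)%:E < tau w])).
    apply: le_measure; rewrite ?inE.
    + rewrite -[X in measurable X]setTI.
      exact: (mtau measurableT (@emeasurable_set1 R +oo)).
    + rewrite -[X in measurable X]setTI; exact: emeasurable_fun_o_infty.
    + by move=> w /= ->; rewrite ltry.
  rewrite tau_gt ?divr_ge0// ?(ltW lam0)// lee_fin mulrCA divff ?gt_eqF// mulr1.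
  by rewrite -[leRHS]lnK// ler_expR lerNl ler_normr lexx orbT.
- by move=> w /= /negP; rewrite -leNgt leye_eq => /eqP.
Qed.

Lemma measurable_fine_time : measurable_fun setT (fun w => fine (tau w)).
Proof. exact: measurableT_comp. Qed.

Lemma exponential_prob_tail (a : R) : exponential_prob lam `]a, +oo[ =
  (if (0 <= a)%R then expR (- (lam * a)) else 1%R)%:E.
Proof.
have neg0 (A : set R) : measurable A -> A `<=` `]-oo, 0%R[ ->
    exponential_prob lam A = 0.
  move=> mA A0; rewrite /exponential_prob integral0_eq// => x /A0/=.
  by rewrite in_itv/= => x0; rewrite lt0_exponential_pdf.
rewrite -setCitvl [LHS]probability_setC//.
case: ifPn => [a0|]; last first.
  rewrite -ltNge => a0.
  rewrite [X in _ - X]neg0 ?sube0// => x /=; rewrite !in_itv/= => xa.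
  exact: le_lt_trans a0.
rewrite (_ : `]-oo, a]%classic = `]-oo, 0%R[ `|` `[0%R, a]); last first.
  rewrite -itv_bndbnd_setU// bnd_simp//.
rewrite measureU//; first last.
- apply/seteqP; split => x //=; rewrite !in_itv/= => -[x0 /andP[]].
  by rewrite leNgt x0.
rewrite [X in _ - (X + _)]neg0// add0e [X in _ - X]exponential_prob_itvcc0//.
rewrite -EFinB subKr//.
Qed.

Lemma exponential_time_law (B : set R) : measurable B ->
  Q [set w | B (fine (tau w))] = exponential_prob lam B.
Proof.
move=> mB; have mfine : measurable_fun setT
  ((fun w => fine (tau w)) : Omega -> measurableTypeR R) := measurable_fine_time.
pose mfine_mixin := isMeasurableFun.Build _ _ _ _ _ mfine.
pose ff : {mfun Omega >-> measurableTypeR R} :=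
  HB.pack (fun w => fine (tau w)) mfine_mixin.
suff : pushforward Q ff B = exponential_prob lam B by [].
apply: (@measure_unique _ R (measurableTypeR R) (@RGenOInfty.G R)
  (fun n => `](- n%:R)%R, +oo[%classic) _ _ _ _
  (pushforward Q ff) (exponential_prob lam)) => //.
- exact: RGenOInfty.measurableE.
- exact: setI_closed_rays.
- by move=> n; exists (- n%:R)%R.
- apply/seteqP; split => // x _; exists (Num.truncn `|x|).+1 => //=.
  rewrite in_itv/= andbT ltrNl (le_lt_trans _ (truncnS_gt _))//.
  by rewrite ler_normr lexx orbT.
- move=> _ [a ->]; rewrite [RHS]exponential_prob_tail /pushforward.
  case: ifPn => [a0|]; last first.
    rewrite -ltNge => a0; rewrite -[RHS](@probability_setT _ _ _ Q); congr (Q _).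
    apply/seteqP; split => // w _ /=; rewrite in_itv/= andbT.
    by rewrite (lt_le_trans a0)// fine_ge0.
  rewrite -tau_gt//.
  (* the two events differ by the null event that the time is infinite *)
  have [N [mN N0 NS]] := exponential_time_fin.
  have mgt : measurable [set w | a%:E < tau w].
    by rewrite -[X in measurable X]setTI; exact: emeasurable_fun_o_infty.
  have mfgt : measurable (ff @^-1` `]a, +oo[).
    by rewrite -[X in measurable X]setTI; exact: measurable_fine_time.
  rewrite -[RHS](@measureU0 _ _ _ Q _ N)// -[LHS](@measureU0 _ _ _ Q _ N)//.
  congr (Q _); apply/seteqP; split => w /= [|]; [|by right| |by right].
    rewrite in_itv/= andbT => aw.
    have [|Nw] := pselect (N w); [by right|left].
    have : tau w < +oo by apply: contrapT => h; apply: Nw; exact: NS.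
    move: aw (tau0 w); case: (tau w) => // s; by rewrite lte_fin.
  move=> aw.
  have [|Nw] := pselect (N w); [by right|left].
  have : tau w < +oo by apply: contrapT => h; apply: Nw; exact: NS.
  rewrite in_itv/= andbT; move: aw (tau0 w); case: (tau w) => // s.
- move=> k; rewrite /pushforward (le_lt_trans (probability_le1 _ _)) ?ltry//.
  by rewrite -[X in measurable X]setTI; exact: measurable_fine_time.
Qed.

Lemma ge0_integral_exponential_time (h : \bar R -> \bar R) :
  measurable_fun setT h -> (forall t, 0 <= h t) ->
  \int[Q]_w h (tau w) =
  \int[lebesgue_measure]_t (h t%:E * (exponential_pdf lam t)%:E).
Proof.
move=> mh h0.
have mfine : measurable_fun setT
  ((fun w => fine (tau w)) : Omega -> measurableTypeR R) := measurable_fine_time.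
have mhE : measurable_fun setT (fun t : measurableTypeR R => h t%:E).
  exact: measurableT_comp.
transitivity (\int[Q]_w h (fine (tau w))%:E).
  apply: ge0_ae_eq_integral => //.
  - exact: measurableT_comp.
  - exact: (measurableT_comp mhE mfine).
  - apply: filterS exponential_time_fin => w tau_fin _.
    by rewrite fineK// ge0_fin_numE.
transitivity (\int[pushforward Q
  ((fun w => fine (tau w)) : Omega -> measurableTypeR R)]_t h t%:E).
  by rewrite ge0_integral_pushforward// preimage_setT.
apply: ge0_integral_density => //.
- exact: measurable_exponential_pdf.
- by move=> t; rewrite exponential_pdf_ge0// ltW.
- by move=> B mB; exact: exponential_time_law.
Qed.

End exponential_time.

(** * Integrals over independent variables *)

Section independent_integral.
Context {R : realType} d d1 d2 (Omega : measurableType d)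
  (T1 : measurableType d1) (T2 : measurableType d2).
Variables (Q : probability Omega R) (X1 : Omega -> T1) (X2 : Omega -> T2).
Hypotheses (mX1 : measurable_fun setT X1) (mX2 : measurable_fun setT X2).
Hypothesis X12 : forall A B, measurable A -> measurable B ->
  (Q (X1 @^-1` A `&` X2 @^-1` B) = Q (X1 @^-1` A) * Q (X2 @^-1` B))%E.
Local Open Scope ereal_scope.

(** The joint law is the product of the marginals, so this is Tonelli. Both
    integrals stay on the sample space, so that the second variable may be the
    sample point itself, seen through a coarser sigma-algebra. *)
Lemma ge0_integral_independent (F : T1 * T2 -> \bar R) :
  measurable_fun setT F -> (forall p, 0 <= F p) ->
  \int[Q]_w F (X1 w, X2 w) = \int[Q]_w \int[Q]_w' F (X1 w, X2 w').
Proof.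
move=> mF F0.
pose mX1_mixin := isMeasurableFun.Build _ _ _ _ _ mX1.
pose Y1 : {mfun Omega >-> T1} := HB.pack X1 mX1_mixin.
pose mX2_mixin := isMeasurableFun.Build _ _ _ _ _ mX2.
pose Y2 : {mfun Omega >-> T2} := HB.pack X2 mX2_mixin.
have mX12 : measurable_fun setT (fun w => (X1 w, X2 w)).
  exact: measurable_fun_pair.
pose mX12_mixin := isMeasurableFun.Build _ _ _ _ _ mX12.
pose Y12 : {mfun Omega >-> (T1 * T2)%type} :=
  HB.pack (fun w => (X1 w, X2 w)) mX12_mixin.
transitivity (\int[distribution Q Y12]_p F p).
  by rewrite ge0_integral_pushforward// preimage_setT.
transitivity (\int[(distribution Q Y1 \x distribution Q Y2)%E]_p F p).
  by apply: eq_measure_integral => A mA _; exact/esym/product_measure_unique.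
rewrite fubini_tonelli1// /fubini_F.
rewrite ge0_integral_pushforward//; last 2 first.
- exact: measurable_fun_fubini_tonelli_F.
- by move=> x _; apply: integral_ge0.
rewrite preimage_setT; apply: eq_integral => w _ /=.
rewrite ge0_integral_pushforward ?preimage_setT//.
exact: measurable_fun_pair2.
Qed.

End independent_integral.

Section independent_pair.
Context {R : realType} d d1 d2 d3 (Omega : measurableType d)
  (T1 : measurableType d1) (T2 : measurableType d2) (T3 : measurableType d3).
Variables (Q : probability Omega R).
Variables (X1 : Omega -> T1) (X2 : Omega -> T2) (X3 : Omega -> T3).
Hypotheses (mX1 : measurable_fun setT X1) (mX2 : measurable_fun setT X2)
  (mX3 : measurable_fun setT X3).
Local Open Scope ereal_scope.
Hypothesis X123 : forall A B C, measurable A -> measurable B -> measurable C ->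
  Q (X1 @^-1` A `&` X2 @^-1` B `&` X3 @^-1` C) =
  Q (X1 @^-1` A) * Q (X2 @^-1` B) * Q (X3 @^-1` C).

Lemma independent_23 B C : measurable B -> measurable C ->
  Q (X2 @^-1` B `&` X3 @^-1` C) = Q (X2 @^-1` B) * Q (X3 @^-1` C).
Proof.
move=> mB mC; have := X123 measurableT mB mC.
by rewrite preimage_setT setTI probability_setT mul1e.
Qed.

(** For fixed A both sides are finite measures in D, and they agree on
    rectangles. *)
Lemma independent_1_23 A D : measurable A -> measurable D ->
  Q (X1 @^-1` A `&` (fun w => (X2 w, X3 w)) @^-1` D) =
  Q (X1 @^-1` A) * Q ((fun w => (X2 w, X3 w)) @^-1` D).
Proof.
move=> mA mD.
have mXA : measurable (X1 @^-1` A).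
  by rewrite -[X in measurable X]setTI; exact: mX1.
have mX23 : measurable_fun setT (fun w => (X2 w, X3 w)).
  exact: measurable_fun_pair.
pose mX23_mixin := isMeasurableFun.Build _ _ _ _ _ mX23.
pose Y : {mfun Omega >-> (T2 * T3)%type} :=
  HB.pack (fun w => (X2 w, X3 w)) mX23_mixin.
have c0 : (0 <= fine (Q (X1 @^-1` A)))%R by rewrite fine_ge0.
have cE : Q (X1 @^-1` A) = (fine (Q (X1 @^-1` A)))%:E.
  by rewrite fineK// fin_num_measure.
pose G : set (set (T2 * T3)) := [set B `*` C | B in measurable & C in measurable].
suff : pushforward (mrestr Q mXA) Y D = mscale (NngNum c0) (distribution Q Y) D.
  by rewrite /distribution/pushforward/mrestr/mscale/= -cE setIC.
apply: (@measure_unique _ R (T2 * T3)%type G (fun=> setT) _ _ _ _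
  (pushforward (mrestr Q mXA) Y)
  (mscale (NngNum c0) (distribution Q Y))) => //.
- exact: measurable_prod_measurableType.
- move=> _ _ [B1 mB1 [C1 mC1 <-]] [B2 mB2 [C2 mC2 <-]].
  exists (B1 `&` B2); first exact: measurableI.
  by exists (C1 `&` C2); [exact: measurableI|rewrite setXI].
- by move=> _; exists setT => //; exists setT => //; rewrite setXTT.
- by apply/seteqP; split => // x _; exists 0%N.
- move=> _ [B mB [C mC <-]].
  change (Q (X2 @^-1` B `&` X3 @^-1` C `&` X1 @^-1` A) =
    (fine (Q (X1 @^-1` A)))%:E * Q (X2 @^-1` B `&` X3 @^-1` C)).
  by rewrite -cE independent_23// setIC setIA X123// muleA.
- move=> _; change (Q (Y @^-1` setT `&` X1 @^-1` A) < +oo).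
  by rewrite preimage_setT setTI (le_lt_trans (probability_le1 _ _))// ltry.
Qed.

End independent_pair.

Section sampling.
Context {R : realType} d d2 (Omega : measurableType d) (T2 : measurableType d2).
Variables (Q : probability Omega R) (lam : R).
Variables (tau : Omega -> \bar R) (Y : Omega -> T2).
Hypotheses (lam0 : 0 < lam) (tau_exp : is_exponential_time Q lam tau).
Hypothesis mY : measurable_fun setT Y.
Local Open Scope ereal_scope.
Hypothesis indep : forall A B, measurable A -> measurable B ->
  Q (tau @^-1` A `&` Y @^-1` B) = Q (tau @^-1` A) * Q (Y @^-1` B).

(** Conditioning on the exponential time: the other variable keeps its law. *)
Lemma ge0_integral_independent_exponential (G : \bar R * T2 -> \bar R) :
  measurable_fun setT G -> (forall p, 0 <= G p) ->
  \int[Q]_w G (tau w, Y w) =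
  \int[lebesgue_measure]_t ((\int[Q]_w G (t%:E, Y w)) * (exponential_pdf lam t)%:E).
Proof.
move=> mG G0; have [mtau _ _] := tau_exp.
rewrite ge0_integral_independent//.
apply: (ge0_integral_exponential_time lam0 tau_exp
  (h := fun s => \int[Q]_w G (s, Y w))); last by move=> t; exact: integral_ge0.
apply: (measurable_fun_fubini_tonelli_F (m2 := Q) (fun p => G (p.1, Y p.2))) => //.
apply: measurableT_comp => //; apply: measurable_fun_pair => //.
exact: measurableT_comp.
Qed.

End sampling.

(** * First jump of a Poisson process *)

Lemma sub_sigma_measurable_fun d d' (T : measurableType d) (S : measurableType d')
    (G : set (set T)) (f : T -> S) : G `<=` measurable ->
  measurable_fun (setT : set (g_sigma_algebraType G)) f -> measurable_fun setT f.
Proof.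
move=> Gm mf _ B mB.
have := mf measurableT B mB.
by apply: (@smallest_sub _ _ G) => //; exact: sigma_algebra_measurable.
Qed.

Lemma cylinders_measurable {R : realType} d (Omega : measurableType d) d'
    (S : measurableType d') (F : R -> set (set Omega)) (Y : R -> Omega -> S) :
  filtration F -> adapted F Y -> cylinders Y `<=` measurable.
Proof.
move=> [_ Fm _] aY A [t /= t0 [B mB <-]]; rewrite setTI.
by apply: (Fm t) => //; exact: aY.
Qed.

Section first_jump.
Context {R : realType} d (Omega : measurableType d).
Variables (N : R -> Omega -> nat).
Hypothesis N_mono : forall w (s t : R), 0 <= s -> s <= t -> (N s w <= N t w)%N.
Hypothesis N_rc : forall w (t : R), 0 <= t -> \forall s \near t^'+, N s w = N t w.

Lemma jump_time_ge0 n w : (0 <= jump_time N n w)%E.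
Proof. by apply: le_ereal_inf_tmp => _ [t [t0 _] <-]; rewrite lee_fin. Qed.

(** Right-continuity is what makes this exact: a path with N t = 0 has no jump on
    some interval beyond t, so its first jump is strictly later. *)
Lemma jump_time1_gt (t : R) w : 0 <= t ->
  (t%:E < jump_time N 1 w)%E = (N t w == 0)%N.
Proof.
move=> t0; apply/idP/idP.
  rewrite -leqn0 leqNgt; apply: contraTN => Nt.
  rewrite -leNgt; apply: ereal_inf_lbound.
  by exists t.
move=> /eqP Nt0.
have [s ts Ns] : exists2 s, t < s & N s w = 0%N.
  have := N_rc w t0; rewrite Nt0 => h.
  near (t^'+) => s; exists s; last by near: s.
  by near: s; exact: nbhs_right_gt.
apply: (@lt_le_trans _ _ s%:E); first by rewrite lte_fin.
apply: le_ereal_inf_tmp => _ [u [u0 Nu] <-]; rewrite lee_fin leNgt.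
apply/negP => us; have := N_mono w u0 (ltW us).
by rewrite Ns leqn0 => /eqP Nu0; rewrite Nu0 in Nu.
Unshelve. all: by end_near. Qed.

Lemma measurable_jump_time1 :
  measurable_fun (setT : set (g_sigma_algebraType (cylinders N))) (jump_time N 1).
Proof.
apply: (measurability (@ErealGenOInfty.G R)).
  exact: ErealGenOInfty.measurableE.
move=> _ [_ [t ->] <-]; rewrite setTI.
have [t0|t0] := leP 0 t.
  apply: sub_sigma_algebra; exists t => //; exists [set 0%N] => //.
  rewrite setTI; apply/seteqP; split => w /=; rewrite in_itv/= andbT jump_time1_gt//.
    by move=> ->.
  by move/eqP.
rewrite (_ : _ @^-1` _ = setT)//; apply/seteqP; split => // w _ /=.
by rewrite in_itv/= andbT (lt_le_trans _ (jump_time_ge0 _ _))// lte_fin.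
Qed.

End first_jump.

Lemma poisson_jump_time1_gt {R : realType} d (Omega : measurableType d)
    (Q : probability Omega R) F (lam : R) (N : R -> Omega -> nat) (t : R) :
  0 < lam -> poisson_process Q F lam N -> 0 <= t ->
  Q [set w | (t%:E < jump_time N 1 w)%E] = (expR (- (lam * t)))%:E.
Proof.
move=> lam0 [_ N0 Nmono Nrc Nlaw] t0.
rewrite (_ : [set w | _] = [set w | N t w = 0%N]); last first.
  by apply/seteqP; split => w /=; rewrite jump_time1_gt// => /eqP.
move: t0; rewrite le_eqVlt => /predU1P[<-|t0].
  rewrite mulr0 oppr0 expR0 -(@probability_setT _ _ _ Q); congr (Q _).
  by apply/seteqP; split => // w _; exact: N0.
have [+ _] := Nlaw 0 t (lexx _) t0 0%N.
rewrite (_ : [set w | (N t w - N 0%R w)%N = 0%N] =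
  [set w | N t w = 0%N]); last first.
  by apply/seteqP; split => w /=; rewrite N0 subn0.
move=> ->; rewrite /poisson_pmf subr0 mulr_gt0// expr0 fact0 invr1.
by rewrite !mul1r.
Qed.

Lemma first_jump_event {R : realType} d (Omega : measurableType d)
    (Q : probability Omega R) F (lam : R) (N : R -> Omega -> nat) A :
  poisson_process Q F lam N -> measurable A ->
  <<s cylinders N >> (jump_time N 1 @^-1` A).
Proof.
move=> [_ _ Nmono Nrc _] mA.
by rewrite -[X in <<s _ >> X]setTI; exact: (measurable_jump_time1 Nmono Nrc).
Qed.

Lemma first_jump_exponential {R : realType} d (Omega : measurableType d)
    (Q : probability Omega R) F (lam : R) (N : R -> Omega -> nat) :
  0 < lam -> filtration F -> poisson_process Q F lam N ->
  is_exponential_time Q lam (jump_time N 1).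
Proof.
move=> lam0 fF pN; have [aN _ Nmono Nrc _] := pN; split.
- apply: sub_sigma_measurable_fun; last exact: measurable_jump_time1.
  exact: cylinders_measurable aN.
- by move=> w; exact: jump_time_ge0.
- by move=> t; exact: poisson_jump_time1_gt pN.
Qed.

(** * The law of the diffusion as a transition semigroup *)

Section dynkin_measurable.
Context {R : realType} d (T : measurableType d).
Variable k : T -> probability (measurableTypeR R) R.
Local Open Scope ereal_scope.

Lemma measurable_probability_rays :
  (forall a : R, measurable_fun setT (fun p => k p `]a, +oo[%classic)) ->
  forall B, measurable B -> measurable_fun setT (fun p => k p B).
Proof.
move=> kray B mB.
apply: (@dynkin_induction _ (measurableTypeR R) (@RGenOInfty.G R)
   (fun B => measurable_fun setT (fun p => k p B))).
- exact: RGenOInfty.measurableE.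
- exact: setI_closed_rays.
- under eq_fun do rewrite probability_setT; exact: measurable_cst.
- by move=> _ [a ->].
- move=> S mS mkS; under eq_fun do rewrite probability_setC//.
  by apply: emeasurable_funB.
- move=> G mG tG mkG.
  have -> : (fun p => k p (\bigcup_n G n)) =
      (fun p => \sum_(0 <= n <oo) k p (G n)).
    apply/funext => p; rewrite measure_bigcup//.
    by apply: eq_eseriesl => n; rewrite in_setT.
  apply: ge0_emeasurable_sum => // n p _; exact: measure_ge0.
- have := @RGenOInfty.measurableE R; rewrite /measurable/= => <-; exact: mB.
Qed.

End dynkin_measurable.

Section ramp.
Context {R : realType}.

(** Continuous approximations of the indicator of the ray above a. *)
Definition ramp (a : R) (n : nat) (z : R) : R :=
  Num.min 1 (n%:R * Num.max 0 (z - a)).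

Lemma ramp_ge0 a n z : 0 <= ramp a n z.
Proof. by rewrite le_min ler01/= mulr_ge0// le_max lexx. Qed.

Lemma ramp_le1 a n z : ramp a n z <= 1.
Proof. by rewrite ge_min lexx. Qed.

Lemma measurable_ramp a n : measurable_fun setT (ramp a n).
Proof.
apply: measurable_minr => //; apply: measurable_funM => //.
apply: measurable_maxr => //; exact: measurable_funB.
Qed.

Lemma continuous_ramp a n : continuous (ramp a n).
Proof.
move=> z.
apply: (@continuous_min _ _ (fun=> 1) (fun z => n%:R * Num.max 0 (z - a))).
  exact: cvg_cst.
apply: cvgMr.
apply: (@continuous_max _ _ (fun=> 0) (fun z => z - a)); first exact: cvg_cst.
by apply: cvgB; [exact: cvg_id|exact: cvg_cst].
Qed.

Lemma ramp_cvg a z :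
  ramp a n z @[n --> \oo] --> (\1_(`]a, +oo[%classic) z : R).
Proof.
have [za|az] := leP z a.
  rewrite indicE memNset; last first.
    by rewrite /= in_itv/= andbT; apply/negP; rewrite -leNgt.
  rewrite (_ : ramp a ^~ z = fun=> 0); first exact: cvg_cst.
  apply/funext => n; rewrite /ramp max_l ?subr_le0// mulr0 min_r//.
rewrite indicE mem_set/= ?in_itv/= ?az//.
apply: (@cvg_near_cst _ _ _ _ _ _); near=> n.
rewrite /ramp max_r ?subr_ge0 ?(ltW az)// min_l// -ler_pdivrMr ?subr_gt0//.
by near: n; exact: nbhs_infty_ger.
Unshelve. all: by end_near. Qed.

End ramp.

Section markov_kernel.
Context {R : realType} d (Omega : measurableType d).
Variables (E : set R) (P : R -> probability Omega R) (F : R -> set (set Omega)).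
Variables (X : R -> Omega -> R) (x0 : R).
Hypotheses (Ex0 : E x0) (mE : measurable E) (F_filtration : filtration F).
Hypotheses (X_adapted : adapted F X) (X_in : forall w (t : R), 0 <= t -> E (X t w)).
Hypothesis X_cont : forall w, {within `[0, +oo[, continuous (fun t => X t w)}.
Hypothesis X_markov : strong_markov E P F X.
Local Open Scope ereal_scope.

(** Starting at x0 instead of at a point outside the state space makes the family
    of laws measurable on the whole line and gives Chapman-Kolmogorov from every
    starting point. *)
Definition retract (x : R) : R := if x \in E then x else x0.

Lemma retract_in x : E (retract x).
Proof. by rewrite /retract; case: ifPn => // /set_mem. Qed.

Lemma retractE x : E x -> retract x = x.
Proof. by move=> Ex; rewrite /retract mem_set. Qed.

Lemma measurable_retract : measurable_fun setT retract.
Proof.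
apply: measurable_fun_ifT => //; apply: (measurable_fun_bool true).
rewrite setTI (_ : _ @^-1` _ = E)//.
by apply/seteqP; split => x /=; [move/set_mem|move/mem_set].
Qed.

Lemma measurable_state (t : R) : measurable_fun setT (X `|t|%R).
Proof.
have [_ Fm _] := F_filtration.
move=> _ B mB; rewrite setTI; apply: (Fm `|t|%R) => //; exact: X_adapted.
Qed.

Definition state (t : R) : {mfun Omega >-> measurableTypeR R} :=
  HB.pack ((X `|t|%R) : Omega -> measurableTypeR R)
    (isMeasurableFun.Build _ _ _ (measurableTypeR R) _ (measurable_state t)).

(** The absolute value turns a process indexed by nonnegative times into a family
    of laws on the whole line, over which Lebesgue integrals are taken. *)
Definition law x (t : R) : probability (measurableTypeR R) R :=
  distribution (P (retract x)) (state t).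

Lemma lawE x (t : R) B : law x t B = P (retract x) (X `|t|%R @^-1` B).
Proof. by []. Qed.

Lemma ge0_integral_law x t h : measurable_fun setT h -> (forall y, 0 <= h y) ->
  \int[law x t]_y h y = \int[P (retract x)]_w h (X `|t|%R w).
Proof. by move=> mh h0; rewrite ge0_integral_pushforward// preimage_setT. Qed.

Lemma measurable_law_state t B :
  measurable B -> measurable_fun setT (fun x => law x t B).
Proof.
move=> mB; have [mP _] := X_markov.
apply: (measurable_comp mE _ (mP _ B (normr_ge0 t) mB) measurable_retract).
by move=> _ [x _ <-]; exact: retract_in.
Qed.

(** The expectation of a ramp function of the state is measurable in the starting
    point and, by dominated convergence along continuous paths, continuous in
    time, hence jointly measurable. Ramps converge to indicators of rays, and rays
    generate the Borel sets. *)
Lemma measurable_law B : measurable B ->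
  measurable_fun setT (fun p : R * R => law p.1 p.2 B).
Proof.
apply: (@measurable_probability_rays _ _ (R * R)%type (fun p => law p.1 p.2)) => a.
pose c n y (t : R) := \int[P (retract y)]_w (ramp a n (X `|t|%R w))%:E.
have mcX n (t : R) : measurable_fun setT (fun w => (ramp a n (X `|t|%R w))%:E).
  apply/measurable_EFinP; apply: measurableT_comp; first exact: measurable_ramp.
  exact: measurable_state.
have int1 x : (P (retract x)).-integrable setT (cst 1).
  exact: finite_measure_integrable_cst.
have mc n : measurable_fun setT (fun p : R * R => c n p.1 `|p.2|%R).
  apply: (@measurable_fun_caratheodory R _ R (c n)).
    move=> t t0.
    rewrite (_ : (c n)^~ t = fun y => \int[law y t]_z (ramp a n z)%:E).
      apply: (@measurable_fun_integral_kernel _ _ _ _ R (fun y => law y t)).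
      - by move=> U mU; exact: measurable_law_state.
      - by move=> z; rewrite lee_fin ramp_ge0.
      - by apply/measurable_EFinP; exact: measurable_ramp.
    apply/funext => y; rewrite ge0_integral_law//.
      by apply/measurable_EFinP; exact: measurable_ramp.
    by move=> z; rewrite lee_fin ramp_ge0.
  move=> y s_ s s0 ss.
  have ae_cvg : {ae P (retract y), forall w, [set: Omega] w ->
      (ramp a n (X `|s_ k|%R w))%:E @[k --> \oo] -->
      (ramp a n (X `|s|%R w))%:E}.
    apply: aeW => w _; apply: cvg_EFin; first exact: nearW.
    apply: (continuous_cvg _ (@continuous_ramp R a n _)).
    apply: (@within_continuous_seq _ (fun t => X t w)) => //.
    exact: cvg_norm.
  have ae_le : {ae P (retract y), forall w k, [set: Omega] w ->
      `|(ramp a n (X `|s_ k|%R w))%:E| <= cst 1 w}.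
    by apply: aeW => w k _; rewrite gee0_abs ?lee_fin ?ramp_le1// ramp_ge0.
  have [_ _ H] := dominated_convergence measurableT
    (fun k => mcX n (s_ k)) (mcX n s) ae_cvg (int1 y) ae_le.
  exact: H.
apply: (@emeasurable_fun_cvg _ (R * R)%type R setT
  (fun n p => c n p.1 `|p.2|%R)
  (fun p => law p.1 p.2 `]a, +oo[%classic)) => [//|[y t] _ /=].
have -> : law y t `]a, +oo[%classic =
    \int[P (retract y)]_w (\1_(`]a, +oo[%classic) (X `|t|%R w))%:E.
  rewrite -(@ge0_integral_law y t (fun z => (\1_(`]a, +oo[%classic) z)%:E))//.
  - by rewrite integral_indic// setIT.
  - by apply/measurable_EFinP.
have mI : measurable_fun setT
    (fun w => (\1_(`]a, +oo[%classic) (X `|t|%R w) : R)%:E).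
  by apply/measurable_EFinP; apply: measurableT_comp => //; exact: measurable_state.
have ae_cvg : {ae P (retract y), forall w, [set: Omega] w ->
    (ramp a n (X `|t|%R w))%:E @[n --> \oo] -->
    (\1_(`]a, +oo[%classic) (X `|t|%R w) : R)%:E}.
  apply: aeW => w _; apply: cvg_EFin; first exact: nearW.
  exact: ramp_cvg.
have ae_le : {ae P (retract y), forall w n, [set: Omega] w ->
    `|(ramp a n (X `|t|%R w))%:E| <= cst 1 w}.
  by apply: aeW => w k _; rewrite gee0_abs ?lee_fin ?ramp_le1// ramp_ge0.
have [_ _ H] := dominated_convergence measurableT
  (fun n => mcX n t) mI ae_cvg (int1 y) ae_le.
by rewrite /c normr_id; exact: H.
Qed.

(** The strong Markov property at the constant time s. *)
Lemma chapman_kolmogorov x (s t : R) : (0 <= s)%R -> (0 <= t)%R ->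
  forall B, measurable B -> law x (s + t)%R B = \int[law x s]_y law y t B.
Proof.
move=> s0 t0 B mB; have [Fs Fm _] := F_filtration; have [_ markov] := X_markov.
have FT u : (0 <= u)%R -> F u setT.
  by move=> u0; have [F0 FC _] := Fs u u0; rewrite -(setD0 setT); exact: FC.
have st : stopping_time F (cst s%:E).
  split => [w|u u0]; first by rewrite lee_fin.
  have [su|us] := leP s u.
    by rewrite (_ : [set w | _] = setT); [exact: FT|apply/seteqP; split].
  rewrite (_ : [set w | _] = set0); first by have [] := Fs u u0.
  by apply/seteqP; split => // w /=; rewrite lee_fin leNgt us.
have AT : F_stopped F (cst s%:E) setT.
  split; last by move=> u u0; rewrite setTI; exact: st.2.
  by apply: sub_sigma_algebra; exists 0%R => //=; exact: FT.
have := markov (retract x) (retract_in x) (cst s%:E) st setT AT t B t0 mB.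
rewrite /= (_ : [set w | s%:E < +oo] = setT); last first.
  by apply/seteqP; split => // w _ /=; rewrite ltry.
rewrite !setTI /at_time/= => H.
rewrite lawE ger0_norm ?addr_ge0//.
rewrite [LHS]H ge0_integral_law//; last exact: measurable_law_state.
apply: eq_integral => w _; rewrite (ger0_norm s0) lawE (ger0_norm t0).
by rewrite retractE//; exact: X_in.
Qed.

End markov_kernel.

(** * Sampling the diffusion at independent exponential times *)

Section discount.
Context {R : realType}.

Lemma discount_ge0 (r : R) t : 0 <= discount r t.
Proof. by case: t => //= s; exact: expR_ge0. Qed.

Lemma measurable_discount (r : R) : measurable_fun setT (discount r).
Proof.
rewrite (_ : discount r =
  fun t => if t \is a fin_num then expR (- (r * fine t)) else 0).
  apply: measurable_fun_ifT => //.
    apply: (measurable_fun_bool true); rewrite setTI.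
    rewrite (_ : _ @^-1` _ = ~` ([set +oo%E] `|` [set -oo%E])).
      by apply: measurableC; apply: measurableU.
    by apply/seteqP; split => -[s| |]//=; [move=> _ []|case; left|case; right].
  apply: measurableT_comp => //; apply: measurableT_comp => //.
  by apply: measurable_funM.
by apply/funext => -[].
Qed.

Lemma discount_expweight (r lam t : R) :
  discount r t%:E * expweight lam t = expweight (r + lam) t.
Proof. by rewrite /expweight /= mulrA -expRD -opprD -mulrDl. Qed.

End discount.

Section sampled_diffusion.
Context {R : realType} d (Omega : measurableType d).
Variables (E : set R) (P : R -> probability Omega R) (F : R -> set (set Omega)).
Variables (X : R -> Omega -> R) (x0 : R).
Hypotheses (Ex0 : E x0) (F_filtration : filtration F).
Hypotheses (X_adapted : adapted F X).
Hypothesis X_cont : forall w, {within `[0, +oo[, continuous (fun t => X t w)}.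

(* H generates the information that is independent of the clocks *)
Variable H : set (set Omega).
Hypotheses (H_measurable : H `<=` measurable) (XH : cylinders X `<=` H).

Let OmegaH := g_sigma_algebraType H.

Lemma measurable_idH : @measurable_fun _ _ Omega OmegaH setT (fun w => w).
Proof.
exact: (@sub_sigma_measurable_fun _ _ Omega OmegaH H _ H_measurable
  (@measurable_id _ OmegaH setT)).
Qed.

Lemma measurable_path : measurable_fun setT (fun p : OmegaH * R => X `|p.2| p.1).
Proof.
apply: (@measurable_process R _ OmegaH X) => // t t0 _ B mB.
by apply: sub_sigma_algebra; apply: XH; exists t => //; exists B.
Qed.

Hypothesis mE : measurable E.
Hypothesis X_markov : strong_markov E P F X.

Let K := law E P x0 F_filtration X_adapted.
Let mK B : measurable B -> measurable_fun setT (fun p : R * R => K p.1 p.2 B).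
Proof. exact: measurable_law. Qed.

Local Notation Tr := (@transition R _ (measurableTypeR R) K).
Local Notation Res := (@resolvent R _ (measurableTypeR R) K).
Variables (lam r x : R) (h : R -> \bar R).
Hypotheses (lam0 : 0 < lam) (Ex : E x).
Hypotheses (mh : measurable_fun setT h) (h0 : forall y, (0 <= h y)%E).
Local Open Scope ereal_scope.

Let mhX : measurable_fun setT
  (fun p : \bar R * OmegaH => h (X `|fine p.1|%R p.2)).
Proof.
apply: measurableT_comp => //.
have mg : measurable_fun setT (fun p : \bar R * OmegaH => (p.2, fine p.1)).
  by apply: measurable_fun_pair => //; exact: measurableT_comp.
exact: (measurableT_comp measurable_path mg).
Qed.

Let transition_path (t : R) : Tr t h x = \int[P x]_w h (X `|t|%R w).
Proof. by rewrite /transition ge0_integral_law// retractE. Qed.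

Let mhXt (t : R) : measurable_fun (setT : set Omega) (fun w => h (X `|t|%R w)).
Proof.
apply: measurableT_comp => //; exact: (measurable_state F_filtration X_adapted).
Qed.

Let resolvent_rate (c a : R) : (0 <= c)%R ->
  \int[lebesgue_measure]_t (c%:E * ((expweight a t)%:E * Tr t h x)) =
  c%:E * Res a h x.
Proof.
move=> c0; rewrite ge0_integralZl//.
- apply: emeasurable_funM.
    by apply/measurable_EFinP; exact: measurable_expweight.
  exact: measurable_transition_time.
- by move=> t _; rewrite mule_ge0 ?lee_fin ?expweight_ge0// transition_ge0.
Qed.

(** Given that the clock rings at t, the path still has law P^x; discounting at
    rate r adds r to the rate of the exponential weight. *)
Lemma sampled_resolvent (tau : Omega -> \bar R) :
  is_exponential_time (P x) lam tau ->
  (forall A B, measurable A -> <<s H>> B ->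
    P x (tau @^-1` A `&` B) = P x (tau @^-1` A) * P x B) ->
  \int[P x]_w ((discount r (tau w))%:E * h (at_time X tau w)) =
  lam%:E * Res (r + lam) h x.
Proof.
move=> tau_exp indep; have [_ tau0 _] := tau_exp.
pose G (p : \bar R * OmegaH) := (discount r p.1)%:E * h (X `|fine p.1|%R p.2).
have mG : measurable_fun setT G.
  apply: emeasurable_funM => //.
  apply/measurable_EFinP; apply: measurableT_comp => //.
  exact: measurable_discount.
have G0 p : 0 <= G p by rewrite mule_ge0// lee_fin discount_ge0.
transitivity (\int[P x]_w G (tau w, w)).
  by apply: eq_integral => w _; rewrite /G/at_time/= ger0_norm// fine_ge0.
rewrite (@ge0_integral_independent_exponential _ _ _ _ OmegaH (P x) lam tau
  (fun w => w) lam0 tau_exp measurable_idH)//.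
rewrite -resolvent_rate ?(ltW lam0)//; apply: eq_integral => t _.
rewrite /G/= ge0_integralZl//.
rewrite -transition_path exponential_pdf_expweight -discount_expweight/=.
by rewrite muleAC -EFinM muleA -EFinM; congr (_%:E * _); rewrite mulrCA.
Qed.

(** Given that the first clock rings at t, the second one is still silent with
    probability e^(-lam t), which adds lam once more to the rate. *)
Lemma sampled_resolvent_race (tau1 tau2 : Omega -> \bar R) :
  is_exponential_time (P x) lam tau1 -> is_exponential_time (P x) lam tau2 ->
  (forall A B C, measurable A -> measurable B -> <<s H>> C ->
    P x (tau1 @^-1` A `&` tau2 @^-1` B `&` C) =
    P x (tau1 @^-1` A) * P x (tau2 @^-1` B) * P x C) ->
  \int[P x]_w ((discount r (tau1 w))%:E * h (at_time X tau1 w) *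
                (\1_[set w | (tau1 w < tau2 w)%E] w)%:E) =
  lam%:E * Res (r + lam + lam) h x.
Proof.
move=> tau1_exp tau2_exp indep; have [mtau1 tau10 _] := tau1_exp.
have [mtau2 tau20 tau2_gt] := tau2_exp.
have mtau2H : measurable_fun (setT : set Omega)
    ((fun w => (tau2 w, w)) : Omega -> (\bar R * OmegaH)%type).
  by apply: measurable_fun_pair => //; exact: measurable_idH.
pose G (p : \bar R * (\bar R * OmegaH)) :=
  (discount r p.1)%:E * h (X `|fine p.1|%R p.2.2) *
  (\1_[set q : \bar R * \bar R | (q.1 < q.2)%E] (p.1, p.2.1))%:E.
have mG : measurable_fun setT G.
  apply: emeasurable_funM; last first.
    apply/measurable_EFinP; apply: measurableT_comp; last first.
      by apply: measurable_fun_pair => //; exact: measurableT_comp.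
    apply: measurable_indic.
    rewrite -[X in measurable X]setTI; exact: emeasurable_fun_lt.
  apply: emeasurable_funM.
    apply/measurable_EFinP; apply: measurableT_comp => //.
    exact: measurable_discount.
  have mg : measurable_fun setT
      (fun p : \bar R * (\bar R * OmegaH) => (p.1, p.2.2)).
    by apply: measurable_fun_pair => //; exact: measurableT_comp.
  exact: (measurableT_comp mhX mg).
have G0 p : 0 <= G p by rewrite !mule_ge0// lee_fin// discount_ge0.
transitivity (\int[P x]_w G (tau1 w, (tau2 w, w))).
  apply: eq_integral => w _; rewrite /G/at_time/= ger0_norm ?fine_ge0//.
rewrite (@ge0_integral_independent_exponential _ _ _ _ (\bar R * OmegaH)%type
  (P x) lam tau1 (fun w => (tau2 w, w)) lam0 tau1_exp mtau2H)//; last first.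
  move=> A B mA mB.
  apply: (@independent_1_23 _ _ _ _ _ Omega _ _ OmegaH (P x) tau1 tau2
    (fun w => w)) => //.
  exact: measurable_idH.
rewrite -resolvent_rate ?(ltW lam0)//; apply: eq_integral => t _.
have [t0|t0] := ltP t 0%R.
  by rewrite lt0_exponential_pdf// expweight_lt0// mule0 mul0e mule0.
have -> : \int[P x]_w G (t%:E, (tau2 w, w)) =
    (discount r t%:E)%:E * (expR (- (lam * t)))%:E * Tr t h x.
  rewrite (@ge0_integral_independent _ _ _ _ Omega _ OmegaH (P x) tau2
    (fun w => w) mtau2 measurable_idH _ (fun q => G (t%:E, q)))//.
  - transitivity (\int[P x]_w ((discount r t%:E)%:E * Tr t h x *
        (\1_[set w | (t%:E < tau2 w)%E] w)%:E)).
      apply: eq_integral => w _; rewrite /G/=.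
      rewrite ge0_integralZr//; last 2 first.
      + by apply: measurable_funeM; exact: mhXt.
      + by move=> w' _; rewrite mule_ge0// lee_fin expR_ge0.
      by rewrite ge0_integralZl ?lee_fin ?expR_ge0// -transition_path.
    have mgt : measurable [set w | t%:E < tau2 w].
      by rewrite -[X in measurable X]setTI; exact: emeasurable_fun_o_infty.
    rewrite ge0_integralZl//; last 2 first.
    + exact/measurable_EFinP/measurable_indic.
    + by rewrite mule_ge0 ?lee_fin ?expR_ge0// transition_ge0.
    rewrite integral_indic// setIT.
    by rewrite [X in _ * X]tau2_gt// muleAC.
  - move=> A B mA mB.
    by apply: (@independent_23 _ _ _ _ _ Omega _ _ OmegaH (P x) tau1 tau2
      (fun w => w)).
  - exact: (measurable_fun_pair2 _ mG).
have -> : expweight (r + lam + lam) t =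
    (expR (- (r * t)) * expR (- (lam * t)) * expR (- (lam * t)))%R.
  by rewrite expweightE// -!expRD; congr expR; ring.
rewrite exponential_pdf_expweight expweightE//= -EFinM.
rewrite muleAC -!EFinM muleA -EFinM; congr (_%:E * _); ring.
Qed.

End sampled_diffusion.

(** * Strict positivity of the resolvent *)

Lemma ge0_integral_eq0_ae {R : realType} d (T : measurableType d)
    (nu : {measure set T -> \bar R}) (f : T -> \bar R) :
  measurable_fun setT f -> (forall x, 0 <= f x)%E ->
  (\int[nu]_x f x = 0)%E -> {ae nu, forall x, f x = 0%E}.
Proof.
move=> mf f0 intf; have [H _] := ae_eq_integral_abs nu measurableT mf.
apply: filterS (H _) => [x /(_ I)//|].
by under eq_integral do rewrite gee0_abs//.
Qed.

Section resolvent_positivity.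
Context {R : realType} d (Omega : measurableType d).
Variables (E : set R) (P : R -> probability Omega R) (F : R -> set (set Omega)).
Variables (X : R -> Omega -> R) (x0 : R).
Hypotheses (Ex0 : E x0) (mE : measurable E) (F_filtration : filtration F).
Hypotheses (X_adapted : adapted F X) (X_in : forall w (t : R), 0 <= t -> E (X t w)).
Hypothesis X_cont : forall w, {within `[0, +oo[, continuous (fun t => X t w)}.
Hypothesis X_markov : strong_markov E P F X.
Local Open Scope ereal_scope.

Local Notation K := (law E P x0 F_filtration X_adapted).
Local Notation Tr := (@transition R _ (measurableTypeR R) K).
Local Notation Res := (@resolvent R _ (measurableTypeR R) K).

Lemma eq_resolvent_on a h1 h2 x :
  measurable_fun setT h1 -> (forall y, 0 <= h1 y) ->
  measurable_fun setT h2 -> (forall y, 0 <= h2 y) ->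
  (forall y, E y -> h1 y = h2 y) -> Res a h1 x = Res a h2 x.
Proof.
move=> m1 h10 m2 h20 h12; apply: eq_integral => t _; congr (_ * _).
rewrite /transition !ge0_integral_law//; apply: eq_integral => w _.
by apply: h12; apply: X_in.
Qed.

(** If the resolvent vanishes at x, Tonelli gives a path started at x along which
    h vanishes at almost every time, whereas by continuity this path spends an
    initial time interval where h is positive. *)
Lemma resolvent_eq0_not_near_pos a h x : E x ->
  P x [set w | X 0%R w = x] = 1 ->
  measurable_fun setT h -> (forall y, 0 <= h y) ->
  Res a h x = 0 -> ~ (\forall y \near x, 0 < h y).
Proof.
move=> Ex PX0 mh h0 Res0 hx.
pose G (p : Omega * R) := (expweight a p.2)%:E * h (X `|p.2|%R p.1).
have mX (t : R) : measurable_fun setT (X `|t|%R).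
  exact: (measurable_state F_filtration X_adapted).
have mG : measurable_fun setT G.
  apply: emeasurable_funM.
    apply/measurable_EFinP; apply: measurableT_comp => //.
    exact: measurable_expweight.
  apply: measurableT_comp => //; apply: measurable_process => // t t0.
  by rewrite -(ger0_norm t0).
have G0 p : 0 <= G p by rewrite mule_ge0// lee_fin expweight_ge0.
pose phi w := \int[lebesgue_measure]_t G (w, t).
have mphi : measurable_fun setT phi.
  exact: (measurable_fun_fubini_tonelli_F (m2 := @lebesgue_measure R) G).
have phi0 w : 0 <= phi w by exact: integral_ge0.
have intphi : \int[P x]_w phi w = 0.
  rewrite -[RHS]Res0 /phi.
  rewrite (@fubini_tonelli _ _ Omega (measurableTypeR R) R (P x)
    lebesgue_measure G)//.
  apply: eq_integral => t _; rewrite /G/= ge0_integralZl//.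
  - by rewrite /transition ge0_integral_law// retractE.
  - exact: measurableT_comp.
  - by rewrite lee_fin expweight_ge0.
have ae1 : {ae P x, forall w, phi w = 0} by exact: ge0_integral_eq0_ae.
have ae2 : {ae P x, forall w, X 0%R w = x}.
  have m0 : measurable [set w | X 0%R w = x].
    rewrite -[X in measurable X]setTI.
    by have := mX 0%R; rewrite normr0 => mX0; exact: (mX0 measurableT [set x]).
  exists (~` [set w | X 0%R w = x]); split => //; first exact: measurableC.
  by rewrite probability_setC// PX0 subee.
have P0 : 0 < P x setT by rewrite probability_setT.
have [w [phiw Xw]] : exists w, phi w = 0 /\ X 0%R w = x.
  have ae_proper := ae_properfilter_algebraOfSetsType P0.
  near (almost_everywhere (P x)) => w; exists w; split.
    by near: w.
  by near: w.
have [e /= e0 he] : exists2 e, (0 < e)%R &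
    forall t, (0 <= t < e)%R -> 0 < h (X t w).
  have A0 : `[0%R, +oo[%classic (0%R : R) by rewrite /= in_itv/= lexx.
  have /subspace_continuousP/(_ 0%R A0) cX := @X_cont w.
  have hX0 : \forall y \near X 0%R w, 0 < h y by rewrite Xw.
  have [e/= e0 he] := cX _ hX0.
  exists e => // t /andP[t0 te]; apply: he; last by rewrite /= in_itv/= t0.
  by rewrite /ball/= sub0r normrN ger0_norm.
have [N [mN N0 GN]] : {ae lebesgue_measure, forall t, G (w, t) = 0}.
  apply: ge0_integral_eq0_ae => //.
  exact: (measurable_fun_pair2 _ mG).
have : lebesgue_measure `[0%R, e[%classic <= lebesgue_measure N.
  apply: le_measure; rewrite ?inE//= => t; rewrite /= in_itv/= => /andP[t0 te].
  apply: GN => /=; rewrite /G/= ger0_norm// expweightE// => /eqP.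
  rewrite mule_eq0 eqe expR_eq0 orFb => /eqP ht0.
  by have := he t; rewrite t0 te ht0 ltxx => /(_ isT).
rewrite N0 lebesgue_measure_itv/= lte_fin e0 sube0 lee_fin leNgt.
by rewrite e0.
Unshelve. all: by end_near. Qed.

End resolvent_positivity.

(** * Payoff functions on the state space *)

Section semicontinuity_on_open.
Context {R : realType}.
Variables (E : set R) (E_open : open E).

(** Lower semicontinuity on an open set, in terms of ambient neighbourhoods. It
    is the common form in which the regularity of l, of the opposite of u and of v
    enters: it yields measurability as well as persistence of strict
    inequalities. *)
Definition stays_above (f : R -> R) :=
  forall x a, E x -> a < f x -> \forall y \near x, a < f y.

Lemma lsc_stays_above f : lsc_on E f -> stays_above f.
Proof.
move=> lf x a Ex afx.
have [|V xV Vf] := lf (x : subspace E) a; first by rewrite lte_fin.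
have Eo : E° x by move: E_open; rewrite openE; exact.
move: xV; rewrite -(nbhs_subspace_interior Eo); apply: filterS => y /Vf.
by rewrite lte_fin.
Qed.

Lemma usc_stays_above f : usc_on E f -> stays_above (fun x => - f x).
Proof.
move=> uf x a Ex; rewrite ltrNr => fxa.
have [V xV Vf] := uf (x : subspace E) (- a) fxa.
have Eo : E° x by move: E_open; rewrite openE; exact.
move: xV; rewrite -(nbhs_subspace_interior Eo); apply: filterS => y /Vf.
by rewrite ltrNr.
Qed.

Lemma continuous_stays_above f : {within E, continuous f} -> stays_above f.
Proof.
rewrite continuous_open_subspace// => cf x a Ex afx.
have /cf : x \in E by exact: mem_set.
by move/cvgr_gt; exact.
Qed.

Lemma measurable_stays_above f : stays_above f -> measurable_fun E f.
Proof.
move=> sf; apply: (measurability (@RGenOInfty.G R)).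
  exact: RGenOInfty.measurableE.
move=> _ [_ [a ->] <-]; apply: open_measurable.
rewrite openE => x [Ex /=]; rewrite in_itv/= andbT => afx.
apply: filterI; first exact: open_nbhs_nbhs.
by apply: filterS (sf _ _ Ex afx) => y; rewrite /= in_itv/= andbT.
Qed.

End semicontinuity_on_open.

Section extension_by_zero.
Context {R : realType}.
Variables (E : set R) (mE : measurable E).

Definition ext0 (f : R -> R) (y : R) : \bar R := ((f \_ E) y)%:E.

Lemma ext0E f y : E y -> ext0 f y = (f y)%:E.
Proof. by move=> Ey; rewrite /ext0 patchE mem_set. Qed.

Lemma ext0_ge0 f : (forall y, E y -> 0 <= f y) -> forall y, (0 <= ext0 f y)%E.
Proof. by move=> f0 y; rewrite lee_fin; apply: restrict_ge0 => z; exact: f0. Qed.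

Lemma measurable_ext0 f : measurable_fun E f -> measurable_fun setT (ext0 f).
Proof.
move=> mf; apply/measurable_EFinP; apply/measurable_restrict => //.
by rewrite setTI.
Qed.

End extension_by_zero.

(** * Comparison of the two games *)

Section game_algebra.
Context {R : realDomainType}.
Implicit Types l u v : R.

(** The one-step payoff of the common game plus the continuation value, minus the
    sum of the two one-step payoffs of the independent game. *)
Definition one_step_gap l u v : R :=
  Num.max l (Num.min v u) + v - (Num.max l v + Num.min u v).

Lemma one_step_gap_ge0 l u v : 0 <= one_step_gap l u v.
Proof.
rewrite /one_step_gap /Num.max /Num.min; repeat case: ifP => //; lra.
Qed.

Lemma one_step_gap_gt0 l u v : u < l -> u < v -> 0 < one_step_gap l u v.
Proof.
rewrite /one_step_gap /Num.max /Num.min; repeat case: ifP => //; lra.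
Qed.

End game_algebra.

Theorem proposition3p24 (R : realType)
  (d : measure_display) (Omega : measurableType d)
  (E : set R) (P : R -> probability Omega R) (F : R -> set (set Omega))
  (W X : R -> Omega -> R) (r lam : R) (l u : R -> R) (Minf : Omega -> R)
  (NC NM Nm : R -> Omega -> nat) (vC vI : R -> R)
  (E_open : open E) (E_interval : is_interval E) (E_nonempty : E !=set0)
  (F_filtration : filtration F) (F_usual : usual_conditions E P F)
  (X_diffusion : linear_diffusion E P F W X)
  (r_gt0 : 0 < r) (lam_gt0 : 0 < lam)
  (l_ge0 : forall x, E x -> 0 <= l x) (u_ge0 : forall x, E x -> 0 <= u x)
  (Minf_meas : forall B, measurable B -> F_infty F (Minf @^-1` B))
  (NC_poisson : forall x, E x -> poisson_process (P x) F lam NC)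
  (NC_indep : forall x, E x ->
     indep2 (P x) <<s cylinders NC >>
       <<s cylinders X `|` preimage_set_system setT Minf measurable >>)
  (NM_poisson : forall x, E x -> poisson_process (P x) F lam NM)
  (Nm_poisson : forall x, E x -> poisson_process (P x) F lam Nm)
  (NMm_indep : forall x, E x ->
     indep3 (P x) <<s cylinders NM >> <<s cylinders Nm >>
       <<s cylinders X `|` preimage_set_system setT Minf measurable >>)
  (l_lsc : lsc_on E l) (u_usc : usc_on E u)
  (vC_value : forall x, E x ->
     is_game_value (poisson_stopping_times F NC) (poisson_stopping_times F NC)
       (expected_payoff P r l u X Minf x) (vC x)%:E)
  (vC_eq : forall x, E x ->
     let T1 := jump_time NC 1 in
     (vC x)%:E = 'E_(P x)[(fun w =>
        discount r (T1 w) *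
        Num.max (l (at_time X T1 w))
          (Num.min (vC (at_time X T1 w)) (u (at_time X T1 w))))%R]%E)
  (vI_value : forall x, E x ->
     is_game_value (poisson_stopping_times F NM) (poisson_stopping_times F Nm)
       (expected_payoff P r l u X Minf x) (vI x)%:E)
  (vI_eq : forall x, E x ->
     let TM1 := jump_time NM 1 in let Tm1 := jump_time Nm 1 in
     (vI x)%:E = 'E_(P x)[(fun w =>
        discount r (mine (TM1 w) (Tm1 w)) *
        (Num.max (l (at_time X TM1 w)) (vI (at_time X TM1 w)) *
           \1_([set w | (TM1 w < Tm1 w)%E]) w +
         Num.min (u (at_time X Tm1 w)) (vI (at_time X Tm1 w)) *
           \1_([set w | (Tm1 w < TM1 w)%E]) w))%R]%E)
  (vIC : forall x, E x -> vI x = vC x)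
  (v_cont : {within E, continuous vI}) :
  forall x, E x -> Num.min (vI x) (l x) <= u x.
Proof.
move=> x Ex; rewrite leNgt; apply/negP => ux.
have [[X_adapted X_in] X_cont X0 X_markov _] := X_diffusion.
have mE : measurable E by exact: open_measurable.
have [_ Fm _] := F_filtration.
have FTm : F_infty F `<=` measurable.
  apply: smallest_sub; first exact: sigma_algebra_measurable.
  by move=> A [t /= t0]; exact: Fm.
pose H := cylinders X `|` preimage_set_system setT Minf measurable.
have mH : H `<=` measurable.
  move=> A [|[B mB <-]].
    exact: (cylinders_measurable F_filtration X_adapted).
  by rewrite setTI; apply: FTm; exact: Minf_meas.
have XH : cylinders X `<=` H by move=> A XA; left.
have l_above := lsc_stays_above E_open l_lsc.
have u_below := usc_stays_above E_open u_usc.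
have v_above := continuous_stays_above E_open v_cont.
have ml := measurable_stays_above E_open l_above.
have mv := measurable_stays_above E_open v_above.
have mu : measurable_fun E u.
  have -> : u = (fun y => - - u y) by apply/funext => y; rewrite opprK.
  apply: measurableT_comp => //.
  exact: (measurable_stays_above E_open u_below).
pose f y := Num.max (l y) (Num.min (vI y) (u y)).
pose a y := Num.max (l y) (vI y).
pose b y := Num.min (u y) (vI y).
pose g y := one_step_gap (l y) (u y) (vI y).
have mf : measurable_fun E f.
  by apply: measurable_maxr => //; exact: measurable_minr.
have ma : measurable_fun E a by exact: measurable_maxr.
have mb : measurable_fun E b by exact: measurable_minr.
have mg : measurable_fun E g.
  apply: measurable_funB; first exact: measurable_funD.
  exact: measurable_funD.
have f0 y : E y -> 0 <= f y by move=> Ey; rewrite le_max l_ge0.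
have state_in w (T : Omega -> \bar R) : (0 <= T w)%E -> E (at_time X T w).
  by move=> T0; apply: X_in; rewrite fine_ge0.
have v0 y : E y -> 0 <= vI y.
  move=> Ey; rewrite vIC// -lee_fin vC_eq// unlock integral_ge0// => w _.
  rewrite lee_fin mulr_ge0 ?discount_ge0// le_max l_ge0//.
  by apply: state_in; exact: jump_time_ge0.
have a0 y : E y -> 0 <= a y by move=> Ey; rewrite le_max l_ge0.
have b0 y : E y -> 0 <= b y by move=> Ey; rewrite le_min u_ge0// v0.
have g0 y : E y -> 0 <= g y by move=> _; exact: one_step_gap_ge0.
have mfE := measurable_ext0 mE mf.
have mvE := measurable_ext0 mE mv.
have maE := measurable_ext0 mE ma.
have mbE := measurable_ext0 mE mb.
have mgE := measurable_ext0 mE mg.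
have f0E := ext0_ge0 f0.
have v0E := ext0_ge0 v0.
have a0E := ext0_ge0 a0.
have b0E := ext0_ge0 b0.
have g0E := ext0_ge0 g0.
pose K := law E P x F_filtration X_adapted.
pose Res := @resolvent R _ (measurableTypeR R) K.
(* needed at every y, since the resolvent equation looks at v along the path *)
have common y : E y -> (vI y)%:E = (lam%:E * Res (r + lam)%R (ext0 E f) y)%E.
  move=> Ey.
  have C_exp := first_jump_exponential lam_gt0 F_filtration (NC_poisson y Ey).
  rewrite vIC// vC_eq// unlock.
  rewrite -(sampled_resolvent Ex F_filtration X_adapted X_cont mH XH mE X_markov
    r lam_gt0 Ey mfE f0E C_exp).
    apply: eq_integral => w _.
    have Ew := state_in w _ (jump_time_ge0 NC 1 w).
    by rewrite ext0E// EFinM /f vIC.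
  move=> A B mA HB; apply: NC_indep => //.
  exact: (first_jump_event (NC_poisson y Ey)).
have indep_race y A B C : E y -> measurable A -> measurable B -> <<s H>> C ->
  (P y (jump_time NM 1 @^-1` A `&` jump_time Nm 1 @^-1` B `&` C) =
   P y (jump_time NM 1 @^-1` A) * P y (jump_time Nm 1 @^-1` B) * P y C)%E.
  move=> Ey mA mB HC; apply: NMm_indep => //.
    exact: (first_jump_event (NM_poisson y Ey)).
  exact: (first_jump_event (Nm_poisson y Ey)).
have mK B : measurable B -> measurable_fun setT (fun p : R * R => K p.1 p.2 B).
  move=> mB.
  exact: (measurable_law Ex mE F_filtration X_adapted X_cont X_markov mB).
pose p y := (ext0 E a y + ext0 E b y)%E.
have mp : measurable_fun setT p by exact: emeasurable_funD.
have p0 y : (0 <= p y)%E by exact: adde_ge0.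
have indep : (vI x)%:E = (lam%:E * Res (r + lam + lam)%R p x)%E.
  have M_exp := first_jump_exponential lam_gt0 F_filtration (NM_poisson x Ex).
  have m_exp := first_jump_exponential lam_gt0 F_filtration (Nm_poisson x Ex).
  have mX t : 0 <= t -> measurable_fun setT (X t).
    move=> t0; rewrite -(ger0_norm t0).
    exact: (measurable_state F_filtration X_adapted).
  have mpart h (tau1 tau2 : Omega -> \bar R) : measurable_fun setT (ext0 E h) ->
      is_exponential_time (P x) lam tau1 -> is_exponential_time (P x) lam tau2 ->
      measurable_fun setT (fun w =>
        ((discount r (tau1 w))%:E * ext0 E h (at_time X tau1 w) *
         (\1_[set w | (tau1 w < tau2 w)%E] w)%:E)%E).
    move=> mh [mtau1 tau10 _] [mtau2 _ _]; apply: emeasurable_funM; last first.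
      apply/measurable_EFinP/measurable_indic.
      by rewrite -[X in measurable X]setTI; exact: emeasurable_fun_lt.
    apply: emeasurable_funM.
      apply/measurable_EFinP; apply: measurableT_comp => //.
      exact: measurable_discount.
    by apply: measurableT_comp => //; exact: measurable_at_time.
  have part0 h (tau1 tau2 : Omega -> \bar R) :
      (forall y, 0 <= ext0 E h y)%E -> forall w,
      (0 <= (discount r (tau1 w))%:E * ext0 E h (at_time X tau1 w) *
        (\1_[set w | (tau1 w < tau2 w)%E] w)%:E)%E.
    by move=> h0 w; rewrite !mule_ge0// lee_fin// discount_ge0.
  have M_first := sampled_resolvent_race Ex F_filtration X_adapted X_cont mH XH
    mE X_markov r lam_gt0 Ex maE a0E M_exp m_exp
    (fun A B C => @indep_race x A B C Ex).
  have indep_swap A B C : measurable A -> measurable B -> <<s H>> C ->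
      (P x (jump_time Nm 1 @^-1` A `&` jump_time NM 1 @^-1` B `&` C) =
       P x (jump_time Nm 1 @^-1` A) * P x (jump_time NM 1 @^-1` B) * P x C)%E.
    move=> mA mB HC; rewrite (setIC (_ @^-1` A)) indep_race//.
    by congr (_ * _)%E; rewrite muleC.
  have m_first := sampled_resolvent_race Ex F_filtration X_adapted X_cont mH XH
    mE X_markov r lam_gt0 Ex mbE b0E m_exp M_exp indep_swap.
  have -> : (Res (r + lam + lam)%R p x =
      Res (r + lam + lam)%R (ext0 E a) x + Res (r + lam + lam)%R (ext0 E b) x)%E.
    exact: (resolventD mK (r + lam + lam) x maE a0E mbE b0E).
  rewrite ge0_muleDr; [|exact: resolvent_ge0|exact: resolvent_ge0].
  refine (etrans _ (congr2 (fun y z => y + z)%E M_first m_first)).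
  rewrite -ge0_integralD//; first last.
  - exact: mpart.
  - by move=> w _; exact: part0.
  - exact: mpart.
  - by move=> w _; exact: part0.
  rewrite vI_eq// unlock; apply: eq_integral => w _.
  rewrite !ext0E; try by apply: state_in; exact: jump_time_ge0.
  rewrite -!EFinM -EFinD; congr EFin.
  have indic_lt (t1 t2 : Omega -> \bar R) :
      \1_[set w | (t1 w < t2 w)%E] w = (t1 w < t2 w)%E%:R :> R.
    rewrite indicE; congr (_ : bool)%:R.
    by apply/idP/idP => [/set_mem//|?]; exact/mem_set.
  rewrite !indic_lt -/(a _) -/(b _).
  have [Mm|mM|->] := ltgtP (jump_time NM 1 w) (jump_time Nm 1 w).
  - by rewrite !mulr0 !mulr1 !addr0.
  - by rewrite !mulr0 !mulr1 !add0r.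
  - by rewrite !mulr0 addr0 mulr0.
have CK y s t : 0 <= s -> 0 <= t -> forall B, measurable B ->
    (K y (s + t)%R B = \int[K y s]_z K z t B)%E.
  move=> s0 t0 B mB.
  exact: (chapman_kolmogorov Ex mE F_filtration X_adapted X_in X_markov y s0 t0 mB).
have mRf : measurable_fun setT (Res (r + lam) (ext0 E f)).
  exact: (measurable_resolvent mK (r + lam) mfE f0E).
have Rf0 y : (0 <= Res (r + lam)%R (ext0 E f) y)%E.
  exact: (@resolvent_ge0 R _ (measurableTypeR R) K (r + lam) _ y f0E).
(* paths stay in E, where both functions agree *)
have v_path : Res (r + lam + lam) (ext0 E vI) x =
    Res (r + lam + lam) (fun y => lam%:E * Res (r + lam)%R (ext0 E f) y)%E x.
  apply: (eq_resolvent_on P x F_filtration X_adapted X_in (r + lam + lam) x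
    mvE v0E (measurable_funeM _ mRf)) => [y|y Ey].
    by rewrite mule_ge0// lee_fin ltW.
  exact: etrans (ext0E vI Ey) (common y Ey).
have gap y : (ext0 E f y + ext0 E vI y = ext0 E g y + p y)%E.
  rewrite /p /ext0 !patchE; case: ifPn => _; last by rewrite !adde0.
  by rewrite -!EFinD; congr EFin; rewrite /g /one_step_gap subrK.
have Res_g : Res (r + lam + lam) (ext0 E g) x = 0%E.
  apply: (resolvent_gap_eq0 mK CK lam_gt0 mfE f0E mvE v0E mgE g0E mp p0 gap _
    v_path).
    by rewrite -(common x Ex).
  exact: etrans (esym (common x Ex)) indep.
have g_near : \forall y \near x, (0 < ext0 E g y)%E.
  have [uv ul] : u x < vI x /\ u x < l x by apply/andP; rewrite -lt_min.
  (* a level strictly between, so that the three functions separate near x *)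
  pose c := (u x + Num.min (vI x) (l x)) / 2.
  have uc : u x < c by rewrite /c; lra.
  have cm : c < Num.min (vI x) (l x) by rewrite /c; lra.
  have /andP[cv cl] : (c < vI x) && (c < l x) by rewrite -lt_min.
  near=> y.
  have Ey : E y by near: y; exact: open_nbhs_nbhs.
  have uyc : u y < c.
    rewrite -ltrN2; near: y; apply: u_below => //; by rewrite ltrN2.
  have cvy : c < vI y by near: y; exact: v_above.
  have cly : c < l y by near: y; exact: l_above.
  rewrite ext0E// lte_fin; apply: one_step_gap_gt0.
    exact: lt_trans uyc cly.
  exact: lt_trans uyc cvy.
exact: (resolvent_eq0_not_near_pos X_cont Ex (X0 x Ex) mgE g0E Res_g g_near).
Unshelve. all: by end_near. Qed.
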